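(* Under Assumptions 1–3, assume $r_\ell<\min\{m_\ell,n_\ell\}$ for all $\ell$ and $\Delta>0$. Let $T$ be an integer with $T\ge 2+128/(3\underline\delta)+(128\sigma)^2/(9\sqrt{\underline\delta}L\Delta)$ and choose $\beta_1=\Big(1+\sqrt{\tfrac{\underline\delta^{3/2}\sigma^2T}{L\Delta}}\Big)^{-1}$, $\tau=\lceil 64/(3\underline\delta\beta_1)\rceil$, and $\eta=\Big(4L+\sqrt{\tfrac{80L^2}{3\underline\delta\beta_1^2}}+\sqrt{\tfrac{80\tau^2L^2}{3\underline\delta}}+\sqrt{\tfrac{16\tau L^2}{3\beta_1}}\Big)^{-1}$. Then GoLore using small-batch stochastic gradients and MSGD with momentum projection satisfies $\frac1T\sum_{t=0}^{T-1}\mathbb{E}\|\nabla f(x^{(t)})\|_2^2\le C\Big(\frac{L\Delta}{\underline\delta^{5/2}T}+\sqrt{\frac{L\Delta\sigma^2}{\underline\delta^{7/2}T}}\Big)$ for an absolute constant $C$.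
   Context: Parameters $x=(\mathrm{vec}(X_1)^\top,\dots,\mathrm{vec}(X_{N_L})^\top)^\top\in\mathbb{R}^d$, $X_\ell\in\mathbb{R}^{m_\ell\times n_\ell}$; $f(x)=\mathbb{E}_{\xi\sim\mathcal D}F(x;\xi)$; $\nabla_\ell$ is the gradient w.r.t. $X_\ell$. Assumption 1: $\inf f>-\infty$. Assumption 2: $\nabla f$ is $L$-Lipschitz in $\|\cdot\|_2$. Assumption 3: $\mathbb{E}_\xi[\nabla_\ell F(x;\xi)]=\nabla_\ell f(x)$ and $\mathbb{E}_\xi\|\nabla_\ell F(x;\xi)-\nabla_\ell f(x)\|_F^2\le\sigma_\ell^2$ for all $x,\ell$; $\sigma^2=\sum_\ell\sigma_\ell^2$. $\Delta=f(x^{(0)})-\inf f$, $\delta_\ell=r_\ell/\min\{m_\ell,n_\ell\}$, $\underline\delta=\min_\ell\delta_\ell$. $\mathrm{St}_{m,r}=\{P\in\mathbb{R}^{m\times r}:P^\top P=I_r\}$ and $\mathcal U(\mathrm{St}_{m,r})$ is its uniform (Haar) distribution. Algorithm (GoLore with MSGD and momentum projection, small batch): $M_\ell^{(-1)}=0$. For $t=0,\dots,T-1$ draw $\xi^{(t)}\sim\mathcal D$ independently and set $G_\ell^{(t)}=\nabla_\ell F(x^{(t)};\xi^{(t)})$ for every $\ell$. If $t\equiv0\pmod\tau$, sample $P_\ell^{(t)}\sim\mathcal U(\mathrm{St}_{m_\ell,r_\ell})$, $Q_\ell^{(t)}\sim\mathcal U(\mathrm{St}_{n_\ell,r_\ell})$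 independently of everything else; otherwise $P_\ell^{(t)}=P_\ell^{(t-1)}$, $Q_\ell^{(t)}=Q_\ell^{(t-1)}$. If $m_\ell\le n_\ell$: $M_\ell^{(t)}=(1-\beta_1)(P_\ell^{(t)})^\top P_\ell^{(t-1)}M_\ell^{(t-1)}+\beta_1(P_\ell^{(t)})^\top G_\ell^{(t)}$, $X_\ell^{(t+1)}=X_\ell^{(t)}-\eta P_\ell^{(t)}M_\ell^{(t)}$. If $m_\ell>n_\ell$: $M_\ell^{(t)}=(1-\beta_1)M_\ell^{(t-1)}(Q_\ell^{(t-1)})^\top Q_\ell^{(t)}+\beta_1G_\ell^{(t)}Q_\ell^{(t)}$, $X_\ell^{(t+1)}=X_\ell^{(t)}-\eta M_\ell^{(t)}(Q_\ell^{(t)})^\top$. *)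

(* Defs.v *)
From HB Require Import structures.
From mathcomp Require Import all_boot all_order all_algebra.
From mathcomp Require Import all_classical all_reals all_analysis.
Set Implicit Arguments. Unset Strict Implicit. Unset Printing Implicit Defensive.
Import Order.TTheory GRing.Theory Num.Theory.
Local Open Scope classical_set_scope.
Local Open Scope ring_scope.

Section Params.
Variable R : realType.
Variable NL : nat.
Variables m n : 'I_NL -> nat.

Definition params := forall l : 'I_NL, 'M[R]_(m l, n l).

Definition padd (x y : params) : params := fun l => x l + y l.
Definition psub (x y : params) : params := fun l => x l - y l.

Definition frob2 a b (A : 'M[R]_(a, b)) : R := \sum_(i < a) \sum_(j < b) A i j ^+ 2.

Definition psqnorm (x : params) : R := \sum_(l < NL) frob2 (x l).
Definition pnorm (x : params) : R := Num.sqrt (psqnorm x).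
Definition pinner (x y : params) : R :=
  \sum_(l < NL) \sum_(i < m l) \sum_(j < n l) x l i j * y l i j.

Definition is_gradient (f : params -> R) (g : params -> params) : Prop :=
  forall x (eps : R), 0 < eps -> exists2 del : R, 0 < del &
    forall v, pnorm v < del ->
      `|f (padd x v) - f x - pinner (g x) v| <= eps * pnorm v.

Definition lipschitz_grad (g : params -> params) (L : R) : Prop :=
  forall x y, pnorm (psub (g x) (g y)) <= L * pnorm (psub x y).

End Params.

Section Algorithm.
Variable R : realType.
Variable NL : nat.
Variables m n r : 'I_NL -> nat.

Record gstate := GState {
  gx  : params R m n;
  gML : forall l : 'I_NL, 'M[R]_(r l, n l);           (* M_l^(t-1), case m_l <= n_l *)
  gMR : forall l : 'I_NL, 'M[R]_(m l, r l) }.         (* M_l^(t-1), case m_l > n_l *)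

(* GoLore with MSGD and momentum projection, along one sample path.
   G t x   : the stochastic gradient nabla F(x; xi^(t)) used at step t,
   Ps k l  : the k-th sample of P_l (used for t with t %/ tau = k),
   Qs k l  : the k-th sample of Q_l.
   golore_state t = (x^(t), M^(t-1)); M^(-1) = 0. *)
Fixpoint golore_state (x0 : params R m n) (G : nat -> params R m n -> params R m n)
    (Ps : nat -> forall l : 'I_NL, 'M[R]_(m l, r l))
    (Qs : nat -> forall l : 'I_NL, 'M[R]_(n l, r l))
    (beta eta : R) (tau : nat) (t : nat) : gstate :=
  match t with
  | 0 => GState x0 (fun l => 0) (fun l => 0)
  | t'.+1 =>
    let s := golore_state x0 G Ps Qs beta eta tau t' in
    let Gt := G t' (gx s) in
    let P := fun l => Ps (t' %/ tau)%N l in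
    let Pp := fun l => Ps (t'.-1 %/ tau)%N l in
    let Q := fun l => Qs (t' %/ tau)%N l in
    let Qp := fun l => Qs (t'.-1 %/ tau)%N l in
    let ML := fun l => (1 - beta) *: ((P l)^T *m Pp l *m gML s l)
                       + beta *: ((P l)^T *m Gt l) in
    let MR := fun l => (1 - beta) *: (gMR s l *m (Qp l)^T *m Q l)
                       + beta *: (Gt l *m Q l) in
    GState (fun l => if (m l <= n l)%N then gx s l - eta *: (P l *m ML l)
                     else gx s l - eta *: (MR l *m (Q l)^T))
           ML MR
  end.

Definition golore_x x0 G Ps Qs beta eta tau t :=
  gx (golore_state x0 G Ps Qs beta eta tau t).

(* underline delta = min_l r_l / min(m_l, n_l) (all delta_l < 1 here) *)
Definition delta_min : R :=
  \big[Num.min/1]_(l < NL) ((r l)%:R / (minn (m l) (n l))%:R).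

End Algorithm.

Section Probability.
Variable R : realType.
Variables (d : measure_display) (Om : measurableType d).
Variable P : probability Om R.

Definition mx_rv a b (M : Om -> 'M[R]_(a, b)) : Prop :=
  forall i j, measurable_fun setT (fun w => M w i j).

Definition mx_sigma a b (M : Om -> 'M[R]_(a, b)) : set (set Om) :=
  <<s [set E | exists i j (B : set R), measurable B /\
                 E = (fun w => M w i j) @^-1` B] >>.

Definition rv_sigma d' (X : measurableType d') (z : Om -> X) : set (set Om) :=
  [set z @^-1` B | B in measurable].

Definition mutual_indep (I : eqType) (G : I -> set (set Om)) : Prop :=
  forall (s : seq I) (A : I -> set Om), uniq s ->
    (forall i, i \in s -> G i (A i)) ->
    fine (P (\big[setI/setT]_(i <- s) A i)) = \prod_(i <- s) fine (P (A i)).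

(* bounded Lipschitz test functions on matrices (they determine laws) *)
Definition bdd_lip_mx a b (phi : 'M[R]_(a, b) -> R) : Prop :=
  exists K : R, forall A B, `|phi A| <= K /\
     `|phi A - phi B| <= K * Num.sqrt (frob2 (A - B)).

(* M ~ U(St_{a,b}): M takes values in the Stiefel manifold and its law is
   the (Haar) probability measure invariant under left multiplication by
   the orthogonal group O(a). *)
Definition uniform_stiefel a b (M : Om -> 'M[R]_(a, b)) : Prop :=
  [/\ forall w, (M w)^T *m M w = 1%:M,
      mx_rv M &
      forall U : 'M[R]_a, U^T *m U = 1%:M ->
        forall phi, bdd_lip_mx phi ->
          Rintegral P setT (fun w => phi (U *m M w)) =
          Rintegral P setT (fun w => phi (M w))].

End Probability.

Definition golore_sigmas (R : realType) (NL : nat) (m n r : 'I_NL -> nat)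
  d (Om : measurableType d) d' (Xi : measurableType d')
  (xi : nat -> Om -> Xi)
  (Pm : nat -> forall l : 'I_NL, Om -> 'M[R]_(m l, r l))
  (Qm : nat -> forall l : 'I_NL, Om -> 'M[R]_(n l, r l))
  (i : (nat + (nat * 'I_NL * bool))%type) : set (set Om) :=
  match i with
  | inl t => rv_sigma (xi t)
  | inr (k, l, true) => mx_sigma (Pm k l)
  | inr (k, l, false) => mx_sigma (Qm k l)
  end.

Definition golore_beta (R : realType) (dl sig2 L Del : R) (T : nat) : R :=
  (1 + Num.sqrt (dl * Num.sqrt dl * sig2 * T%:R / (L * Del)))^-1.

Definition golore_tau (R : realType) (dl beta : R) : nat :=
  absz (Num.ceil (64 / (3 * dl * beta))).

Definition golore_eta (R : realType) (dl L beta : R) (tau : nat) : R :=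
  (4 * L + Num.sqrt (80 * L ^+ 2 / (3 * dl * beta ^+ 2))
          + Num.sqrt (80 * tau%:R ^+ 2 * L ^+ 2 / (3 * dl))
          + Num.sqrt (16 * tau%:R * L ^+ 2 / (3 * beta)))^-1.

(* Main.v *)
(* Lifting the momentum to full size (P M, resp. M Q^T) turns the algorithm into
   x' = x - eta M' with M' = Pi ((1 - beta) M + beta G), where Pi is a random
   block-diagonal orthogonal projection, redrawn every tau steps, whose mean is
   (r_l / min(m_l, n_l)) I on the block l.  Smoothness gives, along each path,
     f(x') <= f(x) - eta/2 |Pi g|^2 - eta/2 (1 - L eta) |M'|^2 + eta/2 |M' - Pi g|^2.
   The error |M' - Pi g|^2 contracts by the factor 1 - beta up to the drift of
   the gradient, the noise, and one term |g|^2 for each redrawing, which is paid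
   by the tau >= 64 / (3 delta beta) steps of the previous period.  Within a
   period the gradient hardly moves, and at the beginning of the period Pi is
   independent of g, so E |Pi g|^2 >= delta E |g|^2.  Summing the pathwise bounds
   and taking the expectation once, the noise enters only through
   E <drift, noise> = 0 and E |noise|^2 <= sigma^2.

   Conditional expectations are replaced by Tonelli's theorem for the identity
   map, seen as a pair of independent random variables with values in Omega
   equipped with two independent sub-sigma-algebras.  The joint measurability
   this requires follows from F(x; xi) being continuous in x and measurable in
   xi, the gradient being a limit of difference quotients. *)
Require Import Defs.
From HB Require Import structures.
From mathcomp Require Import all_boot all_order all_algebra.
From mathcomp Require Import all_classical all_reals all_analysis.
From mathcomp Require Import measurable_realfun fingroup perm.
From mathcomp Require Import zify ring lra.
Set Implicit Arguments. Unset Strict Implicit. Unset Printing Implicit Defensive.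
Import Order.TTheory GRing.Theory Num.Theory.
Import numFieldNormedType.Exports.
Local Open Scope classical_set_scope.
Local Open Scope ring_scope.

(** * Pathwise analysis of momentum descent with projections *)

(** The obstacle is that inside a period the iterates depend on the projection in force. The
    pathwise inequality therefore carries two quantities without a definite sign unchanged to the
    end: the defect [|Pi g|^2 - delta |g|^2] at the start of each period, and the cross term between
    drift and noise. Only their expectations are controlled, so all the rest is deterministic and is
    proved in an abstract inner product space. The budget for [|g|^2] is as follows. Moving from the
    start of the period to the current step uses [|u + v|^2 >= |u|^2 / 2 - |v|^2] twice and leaves
    [delta / 4]; the refreshes take [3/32 delta], which is what the constant 64/3 in [tau] allows;
    [5/32 delta] remains. The multiples of [|M'|^2] produced on the way are of four kinds, and each
    is paid by one of the four summands of [1 / eta]. *)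

Lemma card_divn_eq_le (T tau k : nat) : (0 < tau)%N ->
  (#|[pred t : 'I_T | t %/ tau == k]| <= tau)%N.
Proof.
move=> tau0; rewrite -[X in (_ <= X)%N](card_ord tau).
pose h (t : 'I_T) : 'I_tau := Ordinal (ltn_pmod t tau0).
apply: (@leq_card_in _ _ h) => // s t; rewrite !inE => /eqP sk /eqP tk [st].
by apply: val_inj; rewrite /= (divn_eq s tau) (divn_eq t tau) sk tk st.
Qed.

(** The horizon [T] may cut the last period short, but a step with [tau %| t.+1] closes its period,
    which then lies wholly below [T]. *)
Lemma card_divn_eq_full (T tau t : nat) : (0 < tau)%N -> (t < T)%N ->
  (tau %| t.+1)%N -> (tau <= #|[pred s : 'I_T | s %/ tau == t %/ tau]|)%N.
Proof.
move=> tau0 tT taut; rewrite -[X in (X <= _)%N](card_ord tau).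
have tE : t.+1 = ((t %/ tau).+1 * tau)%N.
  by rewrite -[LHS](divnK taut) divnS// taut.
have lt_T (i : 'I_tau) : (t %/ tau * tau + i < T)%N.
  by have := ltn_ord i; move: tE; nia.
pose h (i : 'I_tau) : 'I_T := Ordinal (lt_T i).
have h_inj : injective h by move=> i j [] /addnI ij; exact: val_inj.
rewrite -(fintype.card_image h_inj).
apply: subset_leq_card; apply/fintype.subsetP => s /fintype.imageP[i _ ->].
by rewrite inE /= divnMDl// (divn_small (ltn_ord i)) addn0.
Qed.

(** A period has a single last step, so in [sum_jump_le] no step is charged for more than one
    refresh. *)
Lemma card_divn_eq_last (T tau k : nat) : (0 < tau)%N ->
  (#|[pred t : 'I_T | (t %/ tau == k) && (tau %| t.+1)%N]| <= 1)%N.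
Proof.
move=> tau0; apply/card_le1_eqP => s t; rewrite !inE.
move=> /andP[/eqP sk sd] /andP[/eqP tk td]; apply: val_inj => /=.
apply: succn_inj; rewrite -(divnK sd) -(divnK td) !divnS// sd td.
by rewrite sk tk.
Qed.

(** * Quadratic inequalities and orthogonal projections for a positive semidefinite form *)

Section inner_product.
Variables (R : realFieldType) (V : lmodType R) (ip : V -> V -> R).
Hypothesis ipC : forall u v, ip u v = ip v u.
Hypothesis ipDl : forall u v w, ip (u + v) w = ip u w + ip v w.
Hypothesis ipZl : forall a u v, ip (a *: u) v = a * ip u v.
Hypothesis ip_ge0 : forall u, 0 <= ip u u.

Local Notation sq u := (ip u u).

Lemma ipDr u v w : ip u (v + w) = ip u v + ip u w.
Proof. by rewrite ipC ipDl !(ipC _ u). Qed.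

Lemma ipZr a u v : ip u (a *: v) = a * ip u v.
Proof. by rewrite ipC ipZl ipC. Qed.

Lemma ipNl u v : ip (- u) v = - ip u v.
Proof. by rewrite -scaleN1r ipZl mulN1r. Qed.

Lemma ipNr u v : ip u (- v) = - ip u v.
Proof. by rewrite ipC ipNl ipC. Qed.

Lemma ip0l v : ip 0 v = 0.
Proof. by rewrite -(scale0r 0) ipZl mul0r. Qed.

Lemma sqD u v : sq (u + v) = sq u + 2 * ip u v + sq v.
Proof. rewrite ipDl !ipDr (ipC v u); ring. Qed.

Lemma sqB u v : sq (u - v) = sq u - 2 * ip u v + sq v.
Proof. rewrite sqD ipNr ipNl ipNr; ring. Qed.

Lemma sqZ a u : sq (a *: u) = a ^+ 2 * sq u.
Proof. rewrite ipZl ipZr; ring. Qed.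

Lemma sqBC u v : sq (u - v) = sq (v - u).
Proof. rewrite !sqB (ipC v u); ring. Qed.

Lemma ip_young (c : R) u v : 0 < c -> 2 * ip u v <= c * sq u + c^-1 * sq v.
Proof.
move=> c0; have := ip_ge0 (c *: u - v); rewrite sqB sqZ ipZl => h.
rewrite -(ler_pM2l c0) mulrDr mulrA mulVKf ?gt_eqF//.
by move: h; lra.
Qed.

Lemma sqD_le2 u v : sq (u + v) <= 2 * sq u + 2 * sq v.
Proof. rewrite sqD; have := ip_young u v (@ltr01 R); lra. Qed.

Lemma sqD_ge_half u v : 2^-1 * sq u - sq v <= sq (u + v).
Proof.
rewrite sqD; have := ip_young (- u) v (_ : 0 < 2^-1).
by rewrite ipNl ipNr ipNl opprK invrK => /(_ ltac:(lra)); lra.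
Qed.

(** Young's inequality with weight [b / (1 - b)], chosen because
    [(1 - b)^2 (1 + b / (1 - b)) = 1 - b]. The weight is undefined at [b = 1], where the left-hand
    side vanishes. *)
Lemma sqD_contract (b : R) u v : 0 < b -> b <= 1 ->
  (1 - b) ^+ 2 * sq (u + v) <= (1 - b) * sq u + b^-1 * sq v.
Proof.
move=> b0 b1; have bn0 : b != 0 by rewrite gt_eqF.
have [->|b1'] := eqVneq b 1.
  rewrite subrr expr0n /= !mul0r add0r invr1 mul1r; exact: ip_ge0.
have b1lt : 0 < 1 - b by rewrite subr_gt0 lt_neqAle b1' b1.
have := ip_young u v (divr_gt0 b0 b1lt).
rewrite invf_div -(ler_pM2l (exprn_gt0 2 b1lt)) => h.
rewrite sqD.
have e1 : (1 - b) ^+ 2 * (b / (1 - b) * ip u u + (1 - b) / b * ip v v) =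
  (1 - b) * b * sq u + (1 - b) ^+ 3 * (b^-1 * sq v).
  by field; rewrite bn0 gt_eqF.
rewrite e1 in h.
have iv0 : 0 <= b^-1 * sq v by rewrite mulr_ge0 ?ip_ge0// invr_ge0 ltW.
have vE : sq v = b * (b^-1 * sq v) by rewrite mulrA divff ?mul1r.
set w := b^-1 * _ in h iv0 vE *; rewrite vE.
have : (1 - b) ^+ 2 * w <= w.
  by rewrite ler_piMl// exprn_ile1// ?ltW//; lra.
by move: h; lra.
Qed.

Lemma sq_sum_le n (v : nat -> V) :
  sq (\sum_(0 <= u < n) v u) <= n%:R * \sum_(0 <= u < n) sq (v u).
Proof.
elim: n => [|n IH]; first by rewrite !big_geq// ip0l mul0r.
rewrite !big_nat_recr//=.
have [->|n0] := posnP n.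
  by rewrite !big_geq// !add0r mul1r.
have n0' : (0 : R) < n%:R^-1 by rewrite invr_gt0 ltr0n.
have := ip_young (\sum_(0 <= i < n) v i) (v n) n0'; rewrite invrK => y.
have s1 : n%:R^-1 * sq (\sum_(0 <= u < n) v u) <= \sum_(0 <= u < n) sq (v u).
  by rewrite ler_pdivrMl ?ltr0n.
rewrite sqD -[n.+1]addn1 natrD mulrDl mul1r mulrDr; lra.
Qed.

Section projections.
Variable Pi : V -> V.
Hypothesis Pi_lin : forall a u v, Pi (a *: u + v) = a *: Pi u + Pi v.
Hypothesis Pi_sym : forall u v, ip (Pi u) v = ip u (Pi v).
Hypothesis Pi_idem : forall u, Pi (Pi u) = Pi u.

Lemma proj_decomp u v : sq (Pi u - v) = sq (Pi u - Pi v) + sq (v - Pi v).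
Proof.
have e1 : ip (Pi u) (Pi v) = ip (Pi u) v by rewrite -Pi_sym Pi_idem.
have e2 : ip (Pi v) (Pi v) = ip v (Pi v) by rewrite Pi_sym Pi_idem.
by rewrite !sqB e1 e2; ring.
Qed.

Lemma projB u v : Pi (u - v) = Pi u - Pi v.
Proof. by rewrite addrC -scaleN1r Pi_lin scaleN1r addrC. Qed.

Lemma sq_proj_add u : sq u = sq (Pi u) + sq (u - Pi u).
Proof.
have e : ip (Pi u) (Pi u) = ip u (Pi u) by rewrite Pi_sym Pi_idem.
by rewrite sqB e; ring.
Qed.

Lemma sq_proj_le u : sq (Pi u) <= sq u.
Proof. by rewrite [leRHS]sq_proj_add lerDl. Qed.

Lemma sq_coproj_le u : sq (u - Pi u) <= sq u.
Proof. by rewrite [leRHS]sq_proj_add lerDr. Qed.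

End projections.

(** A step [- g x / L] minimises the quadratic upper bound, and the value reached is still at least
    [finf]. This pays for the initial momentum error, which is the full gradient at [x 0]. *)
Lemma smooth_sq_grad_le (f : V -> R) (g : V -> V) (L finf : R) x : 0 < L ->
  (forall x v, f (x + v) <= f x + ip (g x) v + L / 2 * sq v) ->
  (forall x, finf <= f x) -> sq (g x) <= 2 * L * (f x - finf).
Proof.
move=> L0 f_smooth f_ge; have Ln0 : L != 0 by rewrite gt_eqF.
have h := le_trans (f_ge _) (f_smooth x (- L^-1 *: g x)).
move: h; rewrite ipZr sqZ.
have -> : L / 2 * ((- L^-1) ^+ 2 * sq (g x)) = 2^-1 * (L^-1 * sq (g x)).
  by field.
rewrite mulNr => h.
have : L^-1 * sq (g x) <= 2 * (f x - finf) by move: h; lra.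
by rewrite ler_pdivrMl//; lra.
Qed.

(** * Deterministic descent along one sample path *)

Section trajectory.
Variables (Pi : nat -> V -> V) (f : V -> R) (g : V -> V) (L finf : R).
Variables (x M N : nat -> V) (beta eta delta : R) (tau : nat).
Hypothesis Pi_lin : forall k a u v, Pi k (a *: u + v) = a *: Pi k u + Pi k v.
Hypothesis Pi_sym : forall k u v, ip (Pi k u) v = ip u (Pi k v).
Hypothesis Pi_idem : forall k u, Pi k (Pi k u) = Pi k u.
Hypothesis L_gt0 : 0 < L.
Hypothesis f_smooth : forall x v, f (x + v) <= f x + ip (g x) v + L / 2 * sq v.
Hypothesis g_lip : forall x y, sq (g x - g y) <= L ^+ 2 * sq (x - y).
Hypothesis f_ge : forall x, finf <= f x.
Hypothesis beta01 : 0 < beta <= 1.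
Hypothesis eta_gt0 : 0 < eta.
Hypothesis tau_gt0 : (0 < tau)%N.
(* [M t] stands for the lifted momentum of step [t - 1]. *)
Hypothesis M0 : M 0 = 0.
Hypothesis MS : forall t, M t.+1 =
  Pi (t %/ tau) ((1 - beta) *: M t + beta *: (g (x t) + N t)).
Hypothesis xS : forall t, x t.+1 = x t - eta *: M t.+1.

Definition drift_dir t := Pi (t %/ tau) ((1 - beta) *: (M t - g (x t))).

Local Notation G t := (sq (g (x t))).
Local Notation m t := (sq (M t.+1)).
Local Notation a t := (sq (M t.+1 - Pi (t %/ tau) (g (x t)))).
Local Notation e t :=
  (2 * beta * ip (drift_dir t) (N t) + beta ^+ 2 * sq (N t)).
Local Notation jump t := (if (tau %| t.+1)%N then G t else 0).

Let beta_gt0 : 0 < beta. Proof. by case/andP: beta01. Qed.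
Let beta_le1 : beta <= 1. Proof. by case/andP: beta01. Qed.

Let PiB k u v : Pi k (u - v) = Pi k u - Pi k v.
Proof. exact: projB. Qed.

Let PiZ k c u : Pi k (c *: u) = c *: Pi k u.
Proof.
have Pi0 : Pi k 0 = 0 by have := PiB k 0 0; rewrite !subrr.
by have := Pi_lin k c u 0; rewrite Pi0 !addr0.
Qed.

Let PiM t : Pi (t %/ tau) (M t.+1) = M t.+1.
Proof. by rewrite MS Pi_idem. Qed.

Lemma momentum_errorE t : M t.+1 - Pi (t %/ tau) (g (x t)) =
  drift_dir t + beta *: Pi (t %/ tau) (N t).
Proof.
rewrite MS -PiB [RHS]addrC -Pi_lin; congr (Pi _ _).
rewrite !scalerDr !scalerN scalerBl scalerBl !scale1r opprB [RHS]addrC.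
rewrite -!addrA; congr (_ + _); rewrite !addrA addrAC; congr (_ + _).
Qed.

(** The drift already lies in the range of the projection, so its product with the projected noise
    equals its product with [N t] itself. The cross term thus pairs [N t] with a vector that does
    not involve it, as its expectation will require. *)
Lemma momentum_error_le t : a t <= sq (drift_dir t) + e t.
Proof.
rewrite momentum_errorE sqD sqZ ipZr -(Pi_sym _ (drift_dir t)) Pi_idem.
have := sq_proj_le (Pi_sym (t %/ tau)) (Pi_idem _) (N t).
rewrite -(ler_pM2l (exprn_gt0 2 beta_gt0)); lra.
Qed.

Lemma grad_step_le t : sq (g (x t) - g (x t.+1)) <= L ^+ 2 * eta ^+ 2 * m t.
Proof.
apply: le_trans (g_lip _ _) _.
by rewrite xS opprB addrC subrK sqZ mulrA.
Qed.

Lemma sq_drift_dir0_le : sq (drift_dir 0) <= G 0.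
Proof.
apply: le_trans (sq_proj_le (Pi_sym _) (Pi_idem _) _) _.
rewrite sqZ M0 sub0r ipNl ipNr opprK ler_piMl// exprn_ile1//; move: beta_gt0 beta_le1; lra.
Qed.

(* When the projection is refreshed at step t + 1, the momentum still lies in
   the range of the old one, so by orthogonality the extra error is exactly the
   part of the gradient that the old projection lost. *)
Lemma sq_drift_dirS_le t : sq (drift_dir t.+1) <=
  (1 - beta) * a t + beta^-1 * (L ^+ 2 * eta ^+ 2 * m t) + jump t.
Proof.
have b0 : 0 <= beta^-1 by rewrite invr_ge0 ltW.
have gs := ler_wpM2l b0 (grad_step_le t).
have h u w : sq u <= (1 - beta) ^+ 2 * sq (w + (g (x t) - g (x t.+1))) ->
    sq u <= (1 - beta) * sq w + beta^-1 * (L ^+ 2 * eta ^+ 2 * m t).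
  move=> hu; have := sqD_contract w (g (x t) - g (x t.+1)) beta_gt0 beta_le1.
  by move: hu gs; lra.
rewrite /drift_dir divnS//; case: ifP => taut.
  rewrite -addrAC; apply: (@le_trans _ _
      ((1 - beta) * sq (M t.+1 - g (x t)) +
       beta^-1 * (L ^+ 2 * eta ^+ 2 * m t))).
    apply: le_trans (sq_proj_le (Pi_sym _) (Pi_idem _) _) _.
    by apply: h; rewrite sqZ addrA subrK.
  have := proj_decomp (Pi_sym (t %/ tau)) (Pi_idem _) (M t.+1) (g (x t)).
  rewrite PiM => ->; rewrite lerD2r mulrDr lerD2l.
  have := sq_coproj_le (Pi_sym (t %/ tau)) (Pi_idem _) (g (x t)).
  have := ip_ge0 (g (x t) - Pi (t %/ tau) (g (x t))).
  by move: beta_gt0 beta_le1; nra.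
rewrite addr0 add0n PiZ PiB PiM sqZ.
have -> : M t.+1 - Pi (t %/ tau) (g (x t.+1)) =
    M t.+1 - Pi (t %/ tau) (g (x t)) + Pi (t %/ tau) (g (x t) - g (x t.+1)).
  by rewrite PiB addrA subrK.
apply: le_trans (sqD_contract _ _ beta_gt0 beta_le1) _.
rewrite lerD2l; apply: le_trans gs; apply: ler_wpM2l => //.
exact: sq_proj_le.
Qed.

Lemma sum_momentum_error_le T :
  beta * \sum_(t < T) a t <= G 0 +
    \sum_(t < T) (beta^-1 * (L ^+ 2 * eta ^+ 2 * m t) + jump t + e t).
Proof.
have c0 t : 0 <= beta^-1 * (L ^+ 2 * eta ^+ 2 * m t) + jump t.
  rewrite addr_ge0//; last by case: ifP.
  by rewrite !mulr_ge0// ?invr_ge0 ?exprn_ge0// ltW.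
case: T => [|T]; first by rewrite !big_ord0 mulr0 addr0.
(* The invariant keeps the latest error with coefficient 1: of this, the contraction passes on
   [1 - beta] and leaves [beta] in the sum. *)
suff : beta * \sum_(t < T) a t + a T <= G 0 +
    \sum_(t < T) (beta^-1 * (L ^+ 2 * eta ^+ 2 * m t) + jump t + e t) + e T.
  rewrite !big_ord_recr /=; have := c0 T; have := ip_ge0 (M T.+1 - Pi (T %/ tau) (g (x T))).
  by move: beta_gt0 beta_le1; nra.
elim: T => [|T IH].
  rewrite !big_ord0 mulr0 add0r addr0.
  by apply: le_trans (momentum_error_le 0) _; rewrite lerD2r sq_drift_dir0_le.
rewrite !big_ord_recr /=.
have := momentum_error_le T.+1; have := sq_drift_dirS_le T.
move: IH; lra.
Qed.

Lemma sq_iterate_diff_le s t : (s <= t)%N ->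
  sq (x t - x s) <= (t - s)%:R * (eta ^+ 2 * \sum_(s <= u < t) m u).
Proof.
move=> st; have -> : x t - x s = \sum_(0 <= u < t - s) (- eta) *: M (u + s).+1.
  rewrite -{1}(subnK st); elim: (t - s)%N => [|k IH].
    by rewrite big_geq// add0n subrr.
  by rewrite big_nat_recr//= -IH addSn xS scaleNr addrAC.
apply: le_trans (sq_sum_le _ _) _; rewrite ler_wpM2l//.
have -> : \sum_(s <= u < t) m u = \sum_(0 <= u < t - s) m (u + s)%N.
  by rewrite -{1}(add0n s) big_addn.
rewrite mulr_sumr.
by apply: ler_sum => u _; rewrite sqZ sqrrN.
Qed.

(** Cauchy-Schwarz over at most [tau] moves. The bound takes in the whole period instead of the
    moves from [s] to [t], so it depends on [t] only through its period and summing it over [t]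
    costs one more factor [tau]. *)
Lemma sq_iterate_diff_period_le T s t : (s <= t < T)%N ->
  (s %/ tau = t %/ tau)%N ->
  sq (x t - x s) <= tau%:R * eta ^+ 2 * \sum_(u < T | (u %/ tau == t %/ tau)%N) m u.
Proof.
move=> /andP[st tT] stE; apply: le_trans (sq_iterate_diff_le st) _.
have ts : (t - s <= tau)%N.
  have := ltn_pmod t tau_gt0; have := divn_eq t tau; have := divn_eq s tau.
  by rewrite stE; lia.
have -> : \sum_(u < T | (u %/ tau == t %/ tau)%N) m u =
    \sum_(0 <= u < T | (u %/ tau == t %/ tau)%N) m u by rewrite big_mkord.
have sT := leq_trans st (ltnW tT).
rewrite (big_cat_nat (leq0n s) sT) (big_cat_nat st (ltnW tT)) /=.
rewrite -mulrA; apply: ler_pM => //.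
- by rewrite mulr_ge0 ?exprn_ge0 ?sumr_ge0// ltW.
- by rewrite ler_nat.
apply: ler_wpM2l; first by rewrite exprn_ge0// ltW.
have -> : \sum_(s <= i < t | (i %/ tau == t %/ tau)%N) m i = \sum_(s <= i < t) m i.
  rewrite [LHS]big_nat_cond [RHS]big_nat; apply: eq_bigl => u.
  apply/andb_idr => /andP[su ut]; rewrite eqn_leq leq_div2r ?(ltnW ut)//=.
  by rewrite -stE leq_div2r.
by rewrite addrCA lerDl addr_ge0// sumr_ge0.
Qed.

Lemma sum_period_sum_le T (F : nat -> R) : (forall t, 0 <= F t) ->
  \sum_(t < T) \sum_(u < T | (u %/ tau == t %/ tau)%N) F u <=
  tau%:R * \sum_(t < T) F t.
Proof.
move=> F0; rewrite (exchange_big_dep xpredT)//= mulr_sumr.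
apply: ler_sum => u _; rewrite sumr_const -[leLHS]mulr_natl ler_wpM2r// ler_nat.
rewrite (leq_trans _ (card_divn_eq_le T (u %/ tau) tau_gt0))//.
by apply/eq_leq/eq_card => t; rewrite !unfold_in /= eq_sym.
Qed.

(* A refresh at step t + 1 costs at most the squared gradient at step t; it is
   charged to the average over the tau steps of the period ending at t. *)
Lemma sum_jump_le T : \sum_(t < T) jump t <=
  2 / tau%:R * \sum_(t < T) G t
  + 2 * L ^+ 2 * eta ^+ 2 * tau%:R * \sum_(t < T) m t.
Proof.
pose Q t := \sum_(u < T | (u %/ tau == t %/ tau)%N) m u.
have tau0 : (0 : R) < tau%:R by rewrite ltr0n.
have Q0 t : 0 <= Q t by apply: sumr_ge0.
pose H s := 2 * G s + 2 * L ^+ 2 * (tau%:R * eta ^+ 2 * Q s).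
have H0 s : 0 <= H s.
  by rewrite addr_ge0 ?mulr_ge0 ?exprn_ge0// ltW.
have jump_le (t : 'I_T) : tau%:R * jump t <=
    \sum_(s < T | (s %/ tau == t %/ tau)%N && (tau %| t.+1)%N) H s.
  case: ifP => taut; last by rewrite mulr0 sumr_ge0.
  under eq_bigl do rewrite andbT.
  apply: le_trans (_ : _ <= \sum_(s < T | (s %/ tau == t %/ tau)%N) G t) _.
    rewrite sumr_const -[leRHS]mulr_natl ler_wpM2r// ler_nat.
    exact: card_divn_eq_full.
  apply: ler_sum => s /eqP stE.
  have st : (s <= t)%N.
    have := ltn_pmod s tau_gt0; have := divn_eq s tau.
    have := divnK taut; rewrite divnS// taut stE; nia.
  have -> : g (x t) = g (x s) + (g (x t) - g (x s)) by rewrite addrCA subrr addr0.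
  apply: le_trans (sqD_le2 _ _) _; rewrite lerD2l -mulrA ler_pM2l//.
  apply: le_trans (g_lip _ _) _; rewrite ler_pM2l ?exprn_gt0// /Q stE.
  by apply: sq_iterate_diff_period_le; rewrite ?st ?ltn_ord.
have : \sum_(t < T) tau%:R * jump t <= \sum_(s < T) H s.
  apply: le_trans (ler_sum _ (fun t _ => jump_le t)) _.
  rewrite (exchange_big_dep xpredT)//=; apply: ler_sum => s _.
  rewrite sumr_const -[leLHS]mulr_natl ler_piMl// lern1.
  rewrite (leq_trans _ (card_divn_eq_last T (s %/ tau) tau_gt0))//.
  by apply/eq_leq/eq_card => t; rewrite !unfold_in /= eq_sym.
rewrite -mulr_sumr big_split/= -mulr_sumr => h.
have h2 : \sum_(i < T) 2 * L ^+ 2 * (tau%:R * eta ^+ 2 * Q i) <=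
   tau%:R * (2 * L ^+ 2 * eta ^+ 2 * tau%:R * \sum_(t < T) m t).
  rewrite -mulr_sumr -mulr_sumr.
  have := @sum_period_sum_le T (fun t => m t) (fun t => ip_ge0 _).
  have c0 : 0 <= 2 * L ^+ 2 * tau%:R * eta ^+ 2.
    by rewrite !mulr_ge0 ?exprn_ge0// ltW.
  by move/(ler_wpM2l c0); rewrite /Q; set A := \sum_(_ < _) _; set B := \sum_(_ < _) _; lra.
rewrite -(ler_pM2l tau0) mulrDr [tau%:R * (2 / _ * _)]mulrA mulrCA divff ?gt_eqF// mulr1.
by move: h h2; lra.
Qed.

(** Two uses of [sqD_ge_half]: one replaces [Pi g] at step [t] by its value at the start of the
    period, the other brings [|g|^2] back from there to step [t]. Hence [delta / 4], and 3/2 as 1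
    from the first use plus [delta / 2 <= 1/2] from the second. The defect at the start of the
    period stays signed, because only its mean is known to be nonnegative. *)
Lemma proj_grad_ge T t : 0 <= delta <= 1 -> (t < T)%N ->
  2^-1 * (sq (Pi (t %/ tau) (g (x (t %/ tau * tau)%N))) - delta * G (t %/ tau * tau)%N)
    + delta / 4 * G t
    - 3 / 2 * L ^+ 2 * (tau%:R * eta ^+ 2 * \sum_(u < T | (u %/ tau == t %/ tau)%N) m u)
  <= sq (Pi (t %/ tau) (g (x t))).
Proof.
move=> /andP[d0 d1] tT; set k := (t %/ tau)%N; set s := (k * tau)%N.
have := @sq_iterate_diff_period_le T s t _ _.
rewrite leq_trunc_div tT mulnK// => /(_ isT erefl).
set D := (X in _ <= X) => Dle.
have D0 : 0 <= D by apply: le_trans Dle.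
have gle : sq (g (x t) - g (x s)) <= L ^+ 2 * D.
  by apply: le_trans (g_lip _ _) _; rewrite ler_pM2l// exprn_gt0.
have h1 := sqD_ge_half (Pi k (g (x s))) (Pi k (g (x t) - g (x s))).
have h2 := sq_proj_le (Pi_sym k) (Pi_idem _) (g (x t) - g (x s)).
have h3 := sqD_ge_half (g (x t)) (g (x s) - g (x t)).
rewrite sqBC in gle.
rewrite (sqBC (g (x t))) in h2.
move: h1 h3; rewrite PiB !(addrC _ (_ - _)) !subrK -PiB => h1 h3.
have h4 := ler_wpM2l d0 h3.
have h5 := ler_wpM2l d0 gle.
have h6 : delta * (L ^+ 2 * D) <= L ^+ 2 * D.
  by rewrite ler_piMl// mulr_ge0// exprn_ge0// ltW.
by rewrite -[tau%:R * _ * _]/D; lra.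
Qed.

Lemma sum_descent_le T :
  \sum_(t < T) sq (Pi (t %/ tau) (g (x t))) + (1 - L * eta) * \sum_(t < T) m t
  <= 2 * (f (x 0) - finf) / eta + \sum_(t < T) a t.
Proof.
have step t : eta / 2 * (sq (Pi (t %/ tau) (g (x t))) + (1 - L * eta) * m t)
    <= f (x t) - f (x t.+1) + eta / 2 * a t.
  have := f_smooth (x t) (- eta *: M t.+1).
  rewrite scaleNr -xS ipNr ipNr ipNl opprK ipZr sqZ sqB.
  (* The move lies in the range of the current projection, so it sees only the projected
     gradient. *)
  have -> : ip (g (x t)) (M t.+1) = ip (M t.+1) (Pi (t %/ tau) (g (x t))).
    by rewrite -Pi_sym PiM ipC.
  by move: eta_gt0; nra.
rewrite -(ler_pM2l (_ : 0 < eta / 2)); last by rewrite divr_gt0.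
rewrite !mulrDr -[X in _ <= X + _](_ : f (x 0) - finf = _); last first.
  by field; rewrite gt_eqF.
apply: le_trans (_ : f (x 0) - f (x T) + eta / 2 * \sum_(t < T) a t <= _); last first.
  by have := f_ge (x T); lra.
elim: T => [|T IH]; first by rewrite !big_ord0; lra.
rewrite !big_ord_recr/= ; have := step T; move: IH; lra.
Qed.

(** The second hypothesis bounds the cost of the refreshes by [3/32 delta] per unit of squared
    gradient, whence [1/4 - 3/32 = 5/32]. The third makes the total coefficient of the squared moves
    nonpositive; its terms come in turn from smoothness, the drift of the gradient in the momentum
    error, the refreshes, and the comparison inside a period. The term in [1 / beta] on the right is
    the initial momentum error. *)
Theorem trajectory_bound T : 0 <= delta <= 1 ->
  2 / tau%:R <= 3 / 32 * (delta * beta) ->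
  L * eta + L ^+ 2 * eta ^+ 2 / beta ^+ 2 + 2 * L ^+ 2 * eta ^+ 2 * tau%:R / beta
    + 3 / 2 * L ^+ 2 * eta ^+ 2 * tau%:R ^+ 2 <= 1 ->
  5 / 32 * delta * \sum_(t < T) G t
    + 2^-1 * \sum_(t < T) (sq (Pi (t %/ tau) (g (x (t %/ tau * tau)%N)))
                            - delta * G (t %/ tau * tau)%N)
  <= 2 * (f (x 0) - finf) / eta + 2 * L * (f (x 0) - finf) / beta
     + \sum_(t < T) (2 * ip (drift_dir t) (N t) + beta * sq (N t)).
Proof.
move=> d01 tauE coefE.
have bn0 : beta != 0 by rewrite gt_eqF.
set GG := \sum_(t < T) G t; set B := \sum_(t < T) (_ - _).
set S := \sum_(t < T) m t.
have S0 : 0 <= S by apply: sumr_ge0.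
have GG0 : 0 <= GG by apply: sumr_ge0.
set PG := \sum_(t < T) sq (Pi (t %/ tau) (g (x t))).
have h1 : 2^-1 * B + delta / 4 * GG
    - 3 / 2 * L ^+ 2 * eta ^+ 2 * tau%:R ^+ 2 * S <= PG.
  have : \sum_(t < T) (2^-1 * (sq (Pi (t %/ tau) (g (x (t %/ tau * tau)%N)))
        - delta * G (t %/ tau * tau)%N) + delta / 4 * G t
      - 3 / 2 * L ^+ 2 * (tau%:R * eta ^+ 2 *
          \sum_(u < T | (u %/ tau == t %/ tau)%N) m u)) <= PG.
    by apply: ler_sum => t _; exact: proj_grad_ge.
  rewrite sumrB big_split/= -!mulr_sumr -/B -/GG.
  have := @sum_period_sum_le T (fun t => m t) (fun t => ip_ge0 _); rewrite -/S.
  set U := \sum_(_ < _) _ => hU.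
  have c0 : 0 <= 3 / 2 * L ^+ 2 * (tau%:R * eta ^+ 2).
    by rewrite !mulr_ge0// ?invr_ge0 ?exprn_ge0// ltW.
  by have := ler_wpM2l c0 hU; lra.
have h2 := sum_descent_le T; rewrite -/PG -/S in h2.
have h3 := sum_momentum_error_le T; set A := \sum_(t < T) a t in h2 h3.
have h4 := sum_jump_le T; rewrite -/GG -/S in h4.
have h5 := smooth_sq_grad_le (x 0) L_gt0 f_smooth f_ge.
move: h3; rewrite !big_split/= -!mulr_sumr -/S.
set J := \sum_(t < T) jump t in h4 *.
set E1 := \sum_(t < T) ip _ _; set E2 := \sum_(t < T) sq (N t) => h3.
have h6 : A <= beta^-1 * (2 * L * (f (x 0) - finf)
    + (beta^-1 * (L ^+ 2 * eta ^+ 2 * S)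
       + (2 / tau%:R * GG + 2 * L ^+ 2 * eta ^+ 2 * tau%:R * S)
       + (2 * beta * E1 + beta ^+ 2 * E2))).
  by rewrite ler_pdivlMl//; move: h3 h4 h5; lra.
have h7 : beta^-1 * (2 / tau%:R * GG) <= 3 / 32 * delta * GG.
  rewrite mulrA ler_wpM2r// ler_pdivrMl//; move: tauE; lra.
have h8 := ler_wpM2r S0 coefE.
have h9 : beta^-1 * (2 * beta * E1 + beta ^+ 2 * E2) = 2 * E1 + beta * E2.
  by field.
rewrite mulrDr [beta^-1 * (_ + _ + _)]mulrDr h9 [beta^-1 * (_ + _)]mulrDr in h6.
rewrite [beta^-1 * (_ + 2 * _ * _ * _ * _)]mulrDr in h6.
rewrite mul1r in h8.
have h10 : beta^-1 * (beta^-1 * (L ^+ 2 * eta ^+ 2 * S)) =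
  L ^+ 2 * eta ^+ 2 / beta ^+ 2 * S by field.
by move: h1 h2 h6 h7 h8; rewrite h10; lra.
Qed.

End trajectory.
End inner_product.

(** * Independence and integration *)

Section independence.
Local Open Scope ereal_scope.
Variables (R : realType) (d : measure_display) (Om : measurableType d).
Variable P : probability Om R.

(** Finite intersections of events from sources other than [i] form a pi-system generating the joint
    sigma-algebra. On it the finite measures [X |-> P (X and B)] and [X |-> P X * P B] agree, hence
    they agree on everything it generates. *)
Lemma mutual_indep_others (I : eqType) (G : I -> set (set Om)) (i : I) A B :
  (forall j, sigma_algebra setT (G j)) -> (forall j, G j `<=` measurable) ->
  mutual_indep P G ->
  <<s \bigcup_(j in [set j | j != i]) G j >> A -> G i B ->
  P (A `&` B) = P A * P B.
Proof.
move=> Gs Gm indepG sA GB; have mB := Gm _ _ GB.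
have GT j : G j setT by have [G0 GC _] := Gs j; rewrite -(setD0 setT); exact: GC.
have GI j X Y : G j X -> G j Y -> G j (X `&` Y).
  by move=> GX GY; have /sigma_algebraP[//|_ _ _] := Gs j; apply.
pose C : set (set Om) := [set A | exists s (F : I -> set Om),
  [/\ uniq s, i \notin s, forall j, G j (F j) &
      A = \big[setI/setT]_(j <- s) F j]].
have bigP s (F : I -> set Om) w :
    (\big[setI/setT]_(j <- s) F j) w <-> forall j, j \in s -> F j w.
  elim: s => [|k s IH]; first by rewrite big_nil.
  rewrite big_cons; split=> [[Fk /IH h] j|h].
    by rewrite inE => /predU1P[->//|]; exact: h.
  split; first by apply: h; rewrite mem_head.
  by apply/IH => j js; apply: h; rewrite inE js orbT.
have Cm : C `<=` measurable.
  move=> _ [s [F [_ _ GF ->]]]; rewrite big_seq.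
  by elim/big_ind : _ => // [X Y|j _]; [exact: measurableI|exact: Gm].
have CI : setI_closed C.
  move=> _ _ [s [F [us is_ GF ->]]] [s' [F' [us' is'_ GF' ->]]].
  (* An index missing from one of the two lists contributes [setT], which every source contains. *)
  exists (undup (s ++ s')), (fun j => (if j \in s then F j else setT) `&`
                                       (if j \in s' then F' j else setT)).
  split; first exact: undup_uniq.
  - by rewrite mem_undup mem_cat negb_or is_.
  - by move=> j; apply: GI; case: ifP.
  apply/seteqP; split => w.
    case=> /bigP h /bigP h'; apply/bigP => j _; split; case: ifP => //; [exact: h|exact: h'].
  move=> /bigP h; split; apply/bigP => j js.
    by have := h j; rewrite mem_undup mem_cat js => /(_ isT) [].
  by have := h j; rewrite mem_undup mem_cat js orbT => /(_ isT) [].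
have indepC X : C X -> P (X `&` B) = P X * P B.
  move=> [s [F [us is_ GF ->]]].
  (* As [i] is not in [s], overwriting the family at [i] does not change the intersection over [s];
     mutual independence for [i :: s] and for [s] then gives the product. *)
  pose F' j := if j == i then B else F j.
  have F'E : \big[setI/setT]_(j <- s) F' j = \big[setI/setT]_(j <- s) F j.
    rewrite big_seq [RHS]big_seq; apply: eq_bigr => j js; rewrite /F'.
    by case: eqP => // ji; rewrite -ji js in is_.
  have GF' j : G j (F' j) by rewrite /F'; case: eqP => [->|].
  have mX : measurable (\big[setI/setT]_(j <- s) F j) by apply: Cm; exists s, F.
  have := indepG (i :: s) F'; rewrite /= us is_ => /(_ isT (fun j _ => GF' j)).
  rewrite !big_cons -(indepG s F' us (fun j _ => GF' j)) F'E {1 2}/F' eqxx => h.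
  rewrite setIC -[LHS]fineK ?fin_num_measure//; last exact: measurableI.
  by rewrite h EFinM !fineK ?fin_num_measure// muleC.
have PB0 : (0 <= fine (P B))%R by rewrite fine_ge0.
pose m1 : {measure set Om -> \bar R} := mrestr P mB.
pose m2 : {measure set Om -> \bar R} := mscale (NngNum PB0) P.
have m2E X : m2 X = P X * P B.
  by rewrite /m2 /= /mscale /= fineK ?fin_num_measure// muleC.
rewrite -m2E -[LHS]/(m1 A).
apply: (@g_sigma_algebra_measure_unique _ _ _ C Cm (fun=> setT)) => //.
- by move=> _; exists [::], (fun=> setT); split => //; rewrite big_nil.
- exact: bigcup_const.
- by move=> X CX; rewrite m2E -indepC.
- by move=> _; rewrite /m1 /= /mrestr setTI -ge0_fin_numE// fin_num_measure.
apply: sub_sigma_algebra2 sA => X [j /= ji GX].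
exists [:: j], (fun k => if k == j then X else setT); split => //.
- by rewrite inE eq_sym.
- by move=> k; case: eqP => [->|].
- by rewrite big_seq1 eqxx.
Qed.
End independence.

Section independent_fubini.
Local Open Scope ereal_scope.
Variables (R : realType) (d d1 d2 : measure_display) (Om : measurableType d).
Variables (T1 : measurableType d1) (T2 : measurableType d2).
Variable P : probability Om R.
Variables (X1 : {RV P >-> T1}) (X2 : {RV P >-> T2}).
Hypothesis indep12 : forall A B, measurable A -> measurable B ->
  P (X1 @^-1` A `&` X2 @^-1` B) = P (X1 @^-1` A) * P (X2 @^-1` B).

Let XX w := (X1 w, X2 w).

Let mXX : measurable_fun setT XX.
Proof. exact: measurable_fun_pair. Qed.

HB.instance Definition _ := isMeasurableFun.Build _ _ _ _ XX mXX.

Let XX_law : forall A, measurable A ->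
  (distribution P X1 \x distribution P X2) A = distribution P XX A.
Proof.
apply: product_measure_unique => A B mA mB.
by rewrite /= /distribution /pushforward -indep12.
Qed.

Lemma indep_tonelli (h : T1 * T2 -> \bar R) :
  measurable_fun [set: T1 * T2] h -> (forall z, 0 <= h z) ->
  \int[P]_w h (X1 w, X2 w) =
  \int[P]_w \int[distribution P X2]_y h (X1 w, y).
Proof.
move=> mh h0.
rewrite -[LHS]/(\int[P]_w (h \o XX) w) -(@ge0_integral_distribution _ _ _ _ _ _ XX)//.
rewrite -(eq_measure_integral _ (fun A mA _ => XX_law mA)) fubini_tonelli1//.
rewrite ge0_integral_distribution//; first exact: measurable_fun_fubini_tonelli_F.
by move=> x; apply: integral_ge0.
Qed.

(** The signed version serves the cross term between drift and noise. Integrability on the product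
    is read off the joint law of the pair. *)
Lemma indep_fubini (h : T1 * T2 -> \bar R) :
  measurable_fun [set: T1 * T2] h -> P.-integrable setT (fun w => h (X1 w, X2 w)) ->
  \int[P]_w h (X1 w, X2 w) =
  \int[P]_w \int[distribution P X2]_y h (X1 w, y).
Proof.
move=> mh ih.
rewrite -[LHS]/(\int[P]_w (h \o XX) w) -(@integral_distribution _ _ _ _ _ _ XX)//.
rewrite -(eq_measure_integral _ (fun A mA _ => XX_law mA)).
have iprod : (distribution P X1 \x distribution P X2).-integrable setT h.
  have /integrableP[_ hlty] := ih; apply/integrableP; split => //.
  rewrite (eq_measure_integral _ (fun A mA _ => XX_law mA)).
  rewrite (@ge0_integral_distribution _ _ _ _ _ _ XX)//.
  exact: measurableT_comp.
rewrite -integral12_prod_meas1//.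
have /integrableP[mF Flty] := integrable_fubini_F iprod.
rewrite integral_distribution//; apply/integrableP; split.
  by apply: measurableT_comp.
rewrite ge0_integral_distribution// in Flty; exact: measurableT_comp.
Qed.
End independent_fubini.

(** * The parameter space as a Euclidean space *)

Section params_lmodule.
Variables (R : realType) (NL : nat) (m n : 'I_NL -> nat).
Local Notation params := (params R m n).

HB.instance Definition _ := gen_eqMixin params.
HB.instance Definition _ := gen_choiceMixin params.

Let params_addrA : associative (@padd R NL m n).
Proof. by move=> x y z; apply: functional_extensionality_dep => l; exact: addrA. Qed.
Let params_addrC : commutative (@padd R NL m n).
Proof. by move=> x y; apply: functional_extensionality_dep => l; exact: addrC. Qed.
Let params_add0r : left_id (fun l => 0 : 'M[R]_(m l, n l)) (@padd R NL m n).
Proof. by move=> x; apply: functional_extensionality_dep => l; exact: add0r. Qed.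
Let params_addNr : left_inverse (fun l => 0 : 'M[R]_(m l, n l))
  (fun (x : params) l => - x l) (@padd R NL m n).
Proof. by move=> x; apply: functional_extensionality_dep => l; exact: addNr. Qed.

(** Addition is [padd] itself, so statements phrased with [padd] and [psub] agree by conversion with
    [+] and [-]. *)
HB.instance Definition _ := GRing.isZmodule.Build params
  params_addrA params_addrC params_add0r params_addNr.

Definition pscale (a : R) (x : params) : params := fun l => a *: x l.

Let params_scalerA a b (x : params) : pscale a (pscale b x) = pscale (a * b) x.
Proof. by apply: functional_extensionality_dep => l; exact: scalerA. Qed.
Let params_scale1r : left_id 1 pscale.
Proof. by move=> x; apply: functional_extensionality_dep => l; exact: scale1r. Qed.
Let params_scalerDr : right_distributive pscale +%R.
Proof. by move=> a x y; apply: functional_extensionality_dep => l; exact: scalerDr. Qed.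
Let params_scalerDl x : {morph pscale^~ x : a b / a + b}.
Proof. by move=> a b; apply: functional_extensionality_dep => l; exact: scalerDl. Qed.

HB.instance Definition _ := GRing.Zmodule_isLmodule.Build R params
  params_scalerA params_scale1r params_scalerDr params_scalerDl.

Implicit Types x y z u v : params.

Lemma pinnerC x y : pinner x y = pinner y x.
Proof. by do 3 apply: eq_bigr => ? _; rewrite mulrC. Qed.

Lemma pinnerDl x y z : pinner (x + y) z = pinner x z + pinner y z.
Proof.
rewrite -big_split /=; apply: eq_bigr => l _; rewrite -big_split /=.
apply: eq_bigr => i _; rewrite -big_split /=; apply: eq_bigr => j _.
by rewrite -mulrDl; congr (_ * _); rewrite mxE.
Qed.

Lemma pinnerZl a x y : pinner (a *: x) y = a * pinner x y.
Proof.
rewrite mulr_sumr; apply: eq_bigr => l _; rewrite mulr_sumr.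
apply: eq_bigr => i _; rewrite mulr_sumr; apply: eq_bigr => j _.
by rewrite mulrA; congr (_ * _); rewrite mxE.
Qed.

Lemma psqnormE x : psqnorm x = pinner x x.
Proof. by do 3 apply: eq_bigr => ? _; rewrite expr2. Qed.

Lemma pinner_ge0 x : 0 <= pinner x x.
Proof. by rewrite -psqnormE; do 3 apply: sumr_ge0 => ? _; rewrite sqr_ge0. Qed.

Lemma pinnerZr a x y : pinner x (a *: y) = a * pinner x y.
Proof. by rewrite pinnerC pinnerZl pinnerC. Qed.

Lemma pinnerNl x y : pinner (- x) y = - pinner x y.
Proof. exact: (ipNl pinnerZl). Qed.

Lemma pinnerNr x y : pinner x (- y) = - pinner x y.
Proof. exact: (ipNr pinnerC pinnerZl). Qed.

Lemma pinner_young c x y : 0 < c ->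
  2 * pinner x y <= c * pinner x x + c^-1 * pinner y y.
Proof. exact: (ip_young pinnerC pinnerDl pinnerZl pinner_ge0). Qed.

Lemma psqnormD_le2 x y : psqnorm (x + y) <= 2 * psqnorm x + 2 * psqnorm y.
Proof.
by rewrite !psqnormE; exact: (sqD_le2 pinnerC pinnerDl pinnerZl pinner_ge0).
Qed.

Lemma psqnormZ a x : psqnorm (a *: x) = a ^+ 2 * psqnorm x.
Proof. by rewrite !psqnormE; exact: (sqZ pinnerC pinnerZl). Qed.

Lemma pnorm_ge0 x : 0 <= pnorm x. Proof. exact: sqrtr_ge0. Qed.

Lemma sqr_pnorm x : pnorm x ^+ 2 = pinner x x.
Proof. by rewrite sqr_sqrtr psqnormE// pinner_ge0. Qed.

Lemma pnormZ a x : pnorm (a *: x) = `|a| * pnorm x.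
Proof.
by rewrite /pnorm psqnormZ sqrtrM ?sqr_ge0// sqrtr_sqr.
Qed.

Lemma lipschitz_grad_sq (g : params -> params) (L : R) x y : 0 < L ->
  lipschitz_grad g L ->
  pinner (g x - g y) (g x - g y) <= L ^+ 2 * pinner (x - y) (x - y).
Proof.
move=> L0 glip; rewrite -!sqr_pnorm -exprMn ler_sqr ?nnegrE ?pnorm_ge0//.
- exact: glip.
- by rewrite mulr_ge0 ?pnorm_ge0// ltW.
Qed.

Lemma gradient_is_derive (f : params -> R) g x v (t : R) : is_gradient f g ->
  is_derive t 1 (fun s : R => f (x + s *: v)) (pinner (g (x + t *: v)) v).
Proof.
move=> fg.
have cvg : (fun h : R => h^-1 *: (f (x + (h *: 1 + t) *: v) - f (x + t *: v)))
    @ 0^' --> pinner (g (x + t *: v)) v.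
  apply/cvgrPdist_le => e e0.
  (* The added 1 allows division when [v] is zero. *)
  pose N := 1 + pnorm v.
  have N0 : 0 < N by rewrite ltr_pwDl// pnorm_ge0.
  have [del del0 hdel] := fg (x + t *: v) (e / N) (divr_gt0 e0 N0).
  near=> h.
  have h0 : h != 0 by near: h; exact: nbhs_dnbhs_neq.
  have hs : `|h| < del / N.
    near: h; apply: dnbhs0_lt; exact: divr_gt0.
  have hv : pnorm (h *: v) < del.
    rewrite pnormZ; apply: le_lt_trans (_ : `|h| * N < _).
      by rewrite ler_wpM2l// lerDr.
    by rewrite -ltr_pdivlMr.
  have := hdel _ hv.
  have xE : padd (x + t *: v) (h *: v) = x + (t + h) *: v.
    by rewrite scalerDl addrA.
  rewrite pnormZ xE.
  rewrite (pinnerC _ (h *: v)) pinnerZl (pinnerC v).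
  rewrite [h *: 1]mulr1 (addrC h t); set A := f _ - f _; set B := pinner _ _.
  rewrite -[A - _](_ : h * (h^-1 * A - B) = _); last first.
    by rewrite mulrBr mulrA divff// mul1r.
  rewrite normrM mulrCA ler_pM2l ?normr_gt0// distrC => hle.
  apply: le_trans hle _.
  rewrite mulrAC ler_pdivrMr// ler_pM2l// lerDr//.
apply: DeriveDef; first by apply/cvg_ex; eexists; exact: cvg.
exact/cvg_lim.
Unshelve. all: by end_near. Qed.

(** The mean value theorem is applied to the gap [q] between [f] on the segment and its quadratic
    majorant, so no gradient has to be integrated. The derivative of [q] at [s > 0] is nonpositive
    by Young's inequality with weight [1 / (L s)] and the Lipschitz bound; at [s = 0] it
    vanishes. *)
Lemma smooth_descent (f : params -> R) g (L : R) x v : 0 < L ->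
  is_gradient f g -> lipschitz_grad g L ->
  f (x + v) <= f x + pinner (g x) v + L / 2 * pinner v v.
Proof.
move=> L0 fg glip.
pose q (s : R) := f (x + s *: v) - (s * pinner (g x) v + s ^+ 2 * (L / 2 * pinner v v)).
pose dq (s : R) := pinner (g (x + s *: v)) v -
  (pinner (g x) v + 2 * s * (L / 2 * pinner v v)).
have dqE (s : R) : is_derive s 1 q (dq s).
  apply: is_deriveB; first exact: gradient_is_derive.
  apply: is_derive_eq.
  rewrite /GRing.scale /= . ring.
have qcont : {within `[0, 1], continuous q}.
  apply: continuous_subspaceT => s.
  by apply/differentiable_continuous/derivable1_diffP; case: (dqE s).
have [s /[!in_itv]/= /andP[s0 s1]] := MVT_segment (@ler01 R) (fun s _ => dqE s) qcont.
rewrite subr0 mulr1 => h.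
have dq0 : dq s <= 0.
  have [->|sn0] := eqVneq s 0.
    by rewrite /dq scale0r addr0; lra.
  have sgt0 : 0 < s by rewrite lt_neqAle eq_sym sn0.
  have Ls0 : 0 < (L * s)^-1 by rewrite invr_gt0 mulr_gt0.
  have := pinner_young (g (x + s *: v) - g x) v Ls0.
  have := lipschitz_grad_sq (x + s *: v) x L0 glip.
  rewrite addrAC subrr add0r (sqZ pinnerC pinnerZl) (pinnerDl _ _ v) (pinnerNl _ v).
  move=> /(ler_wpM2l (ltW Ls0)).
  rewrite invrK [X in _ <= X -> _](_ : _ = L * s * pinner v v); last first.
    by field; rewrite !gt_eqF.
  rewrite /dq; lra.
have : q 1 <= q 0 by rewrite -subr_le0 h.
by rewrite /q scale1r scale0r addr0 expr0n /= !mul0r expr1n !mul1r addr0 subr0; lra.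
Qed.

End params_lmodule.

(** * Joint measurability of the stochastic gradient *)

Lemma measurable_fun_countable_case (R : realType) (d : measure_display)
    (Y : measurableType d) (C : countType) (c : Y -> C) (h : C -> Y -> R) :
  (forall v, measurable [set y | c y = v]) ->
  (forall v, measurable_fun setT (h v)) ->
  measurable_fun setT (fun y => h (c y) y).
Proof.
move=> mc mh _ B mB; rewrite setTI.
have -> : (fun y => h (c y) y) @^-1` B =
    \bigcup_v ([set y | c y = v] `&` h v @^-1` B).
  apply/seteqP; split => [y By|y [v _ [/= -> //]]].
  by exists (c y).
apply: countable_bigcupT_measurable => // v.
by apply: measurableI => //; rewrite -[X in measurable X]setTI; exact: mh.
Qed.

Section caratheodory.
Variables (R : realType) (NL : nat) (m n : 'I_NL -> nat).
Local Notation params := (params R m n).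
Variables (d : measure_display) (Y : measurableType d).

Definition params_rv (X : Y -> params) : Prop :=
  forall l i j, measurable_fun setT (fun y => X y l i j).

Definition pcontinuous (h : params -> R) : Prop :=
  forall x (e : R), 0 < e -> exists2 del : R, 0 < del &
    forall v, pnorm v < del -> `|h (x + v) - h x| <= e.

Lemma psqnorm_le_entry (x : params) (e : R) : (forall l i j, `|x l i j| <= e) ->
  psqnorm x <= (\sum_(l < NL) m l * n l)%:R * e ^+ 2.
Proof.
move=> xe; rewrite natr_sum mulr_suml; apply: ler_sum => l _.
rewrite natrM -mulrA mulr_natl -[m l in leRHS]card_ord -sumr_const.
apply: ler_sum => i _; rewrite mulr_natl -[n l in leRHS]card_ord -sumr_const.
by apply: ler_sum => j _; rewrite -real_normK ?num_real// lerXn2r ?nnegrE// (le_trans _ (xe l i j)).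
Qed.

Let idx := {l : 'I_NL & ('I_(m l) * 'I_(n l))%type}.

(* The point of the lattice (1/(k+1))Z^d just below x, through its integer
   coordinates. *)
Let code (k : nat) (x : params) : {ffun idx -> int} :=
  [ffun c => Num.floor (k.+1%:R * x (tag c) (tagged c).1 (tagged c).2)].
Let grid (k : nat) (v : {ffun idx -> int}) : params :=
  fun l => \matrix_(i, j) ((v (Tagged (fun l => ('I_(m l) * 'I_(n l))%type) (i, j)))%:~R / k.+1%:R).

Let grid_code k (x : params) l i j :
  `|(grid k (code k x) - x) l i j| <= k.+1%:R^-1.
Proof.
have k0 : (0 : R) < k.+1%:R by rewrite ltr0n.
rewrite [X in `|X|](_ : _ = (Num.floor (k.+1%:R * x l i j))%:~R / k.+1%:R - x l i j).
  rewrite -[X in _ - X](mulKf (lt0r_neq0 k0)) [in X in _ - X]mulrC -mulrBl normrM.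
  rewrite [X in _ * X]gtr0_norm ?invr_gt0// ler_piMl ?invr_ge0//.
  have := floor_le_tmp (k.+1%:R * x l i j); have := floorD1_gt (k.+1%:R * x l i j).
  rewrite intrD => h1 h2; rewrite ler_norml; apply/andP; split; lra.
by rewrite !mxE ffunE.
Qed.

(** Once [X] is rounded to a lattice it takes countably many values, and on each of them the
    function is a fixed section [h v]. Continuity in the first argument gives the limit as the
    lattice is refined. *)
Lemma measurable_caratheodory (h : params -> Y -> R) (X : Y -> params) :
  (forall y, pcontinuous (h^~ y)) -> (forall x, measurable_fun setT (h x)) ->
  params_rv X -> measurable_fun setT (fun y => h (X y) y).
Proof.
move=> hc hm Xm.
apply: (@measurable_fun_cvg _ _ _ _ (fun k y => h (grid k (code k (X y))) y)).
  move=> k; apply: (@measurable_fun_countable_case _ _ _ _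
      (fun y => code k (X y)) (fun v y => h (grid k v) y)) => v; last exact: hm.
  have -> : [set y | code k (X y) = v] = \bigcap_(c in [set: idx])
      ((fun y => k.+1%:R * X y (tag c) (tagged c).1 (tagged c).2) @^-1`
         `[(v c)%:~R, (v c + 1)%:~R[%classic).
    apply/seteqP; split => [y <- c _ /=|y /= h1].
      by rewrite ffunE in_itv/= -floor_eq.
    by apply/ffunP => c; rewrite ffunE; apply/eqP; rewrite floor_eq; exact: (h1 c).
  apply: fin_bigcap_measurable => [|c _]; first exact: finite_finset.
  rewrite -[X in measurable X]setTI.
  by apply: (measurable_funM _ (Xm _ _ _)).
move=> y _; apply/cvgrPdist_le => e e0.
have [del del0 hdel] := hc y (X y) e e0.
set N : R := (\sum_(l < NL) m l * n l)%:R.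
(* [N] is the number of coordinates. An error of at most [kk] per entry has squared norm at most
   [N * kk^2], hence at most [(kk * (1 + N))^2]; the added 1 covers [N = 0]. *)
have D0 : 0 < del / (1 + N) by rewrite divr_gt0// ltr_pwDl.
near=> k.
have -> : grid k (code k (X y)) = X y + (grid k (code k (X y)) - X y).
  by rewrite addrC subrK.
rewrite distrC; apply: hdel.
have kD : k.+1%:R^-1 < del / (1 + N).
  by near: k; exact: (near_infty_natSinv_lt (PosNum D0)).
rewrite -(ger0_norm (ltW del0)) -sqrtr_sqr /pnorm ltr_sqrt ?exprn_gt0//.
apply: le_lt_trans (psqnorm_le_entry (grid_code k (X y))) _.
have k0 : (0 : R) <= k.+1%:R^-1 by rewrite invr_ge0.
move: kD; rewrite ltr_pdivlMr ?ltr_pwDl// => kD.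
have N0 : 0 <= N by rewrite ler0n.
set kk := k.+1%:R^-1 in k0 kD *; rewrite -/N.
apply: le_lt_trans (_ : (kk * (1 + N)) ^+ 2 < _); first by nra.
by rewrite ltrXn2r// mulr_ge0// addr_ge0.
Unshelve. all: by end_near. Qed.
End caratheodory.

Section gradient_measurability.
Variables (R : realType) (NL : nat) (m n : 'I_NL -> nat).
Local Notation params := (params R m n).

(** The coordinate vector at entry [(i, j)] of block [l]. Indices are compared as natural numbers
    because [a] and [i] have different types unless [l' = l]. *)
Definition pdelta (l : 'I_NL) (i : 'I_(m l)) (j : 'I_(n l)) : params := fun l' =>
  \matrix_(a, b) [&& l' == l, a == i :> nat & b == j :> nat]%:R.

Lemma pinner_pdelta (x : params) l i j : pinner x (pdelta i j) = x l i j.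
Proof.
rewrite /pinner (bigD1 l)//= (bigD1 i)//= (bigD1 j)//= mxE !eqxx mulr1.
rewrite [X in _ + X + _ + _]big1 => [|b bj]; last first.
  by rewrite mxE !eqxx /= (negPf (_ : b != j :> nat)) ?mulr0.
rewrite [X in _ + X + _]big1 => [|a ai]; last first.
  rewrite big1// => b _; rewrite mxE eqxx /= (negPf (_ : a != i :> nat)) ?mulr0//.
rewrite big1 ?addr0// => l' l'l; rewrite big1// => a _; rewrite big1// => b _.
by rewrite mxE (negPf l'l) mulr0.
Qed.

Lemma gradient_pcontinuous (f : params -> R) g : is_gradient f g -> pcontinuous f.
Proof.
move=> fg x e e0; have [del del0 hdel] := fg x 1 ltr01.
have u0 := pinner_ge0 (g x); set u := pinner (g x) (g x) in u0.
(* Young's inequality with weight [c] bounds the linear part: [c * u <= e] handles the gradient, and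
   [|v|^2 <= |v|] for [|v| < 1] handles the increment. *)
pose c := e / (1 + u).
have c0 : 0 < c by rewrite divr_gt0// ltr_pwDl.
have mm : 0 < Num.min del (Num.min 1 (e / 2 * (1 + c^-1)^-1)).
  by rewrite !lt_min del0 ltr01/= mulr_gt0 ?divr_gt0// invr_gt0 ltr_pwDl// invr_ge0 ltW.
exists (Num.min del (Num.min 1 (e / 2 * (1 + c^-1)^-1))) => // v.
rewrite !lt_min => /and3P[vdel v1 vc].
have := hdel v vdel; rewrite mul1r -[padd x v]/(x + v) => h.
have v0 := pnorm_ge0 v.
have vv : pinner v v <= pnorm v by rewrite -sqr_pnorm expr2 ler_piMl// ltW.
have y1 := pinner_young (g x) v c0.
have y2 := pinner_young (g x) (- v) c0.
rewrite !pinnerNr pinnerNl opprK in y2.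
have cu : c * u <= e.
  by rewrite /c mulrAC ler_pdivrMr ?ltr_pwDl// ler_pM2l// lerDr.
have ci : 0 < c^-1 by rewrite invr_gt0.
have cv : c^-1 * pinner v v <= c^-1 * pnorm v by rewrite ler_pM2l.
have ci1 : 0 < 1 + c^-1 by rewrite ltr_pwDl// ltW.
move: vc; rewrite ltr_pdivlMr// => vc.
move: h; rewrite ler_norml => /andP[h1 h2].
rewrite -/u in y1 y2.
have cv0 : 0 <= c^-1 * pnorm v by rewrite mulr_ge0// ltW.
by rewrite ler_norml; apply/andP; split; lra.
Qed.

Lemma lipschitz_grad_pcontinuous (g : params -> params) (L : R) l i j : 0 < L ->
  lipschitz_grad g L -> pcontinuous (fun x => g x l i j).
Proof.
move=> L0 glip x e e0; exists (e / L); first exact: divr_gt0.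
move=> v; rewrite ltr_pdivlMr// => ve.
have -> : g (x + v) l i j - g x l i j = (g (x + v) - g x) l i j.
  by rewrite mxE [in RHS]mxE.
apply: (le_trans _ (ltW ve)); rewrite mulrC.
apply: (le_trans _ (_ : pnorm (g (x + v) - g x) <= _)); last first.
  have := glip (x + v) x; rewrite -[psub (x + v) x]/(x + v - x).
  by rewrite addrAC subrr add0r.
rewrite -sqrtr_sqr ler_sqrt ?psqnormE ?pinner_ge0//.
set z := g (x + v) - g x; rewrite -psqnormE /psqnorm (bigD1 l)//= /frob2 (bigD1 i)//= (bigD1 j)//=.
by rewrite -!addrA lerDl !addr_ge0//; do ?[apply: sumr_ge0 => ? _]; rewrite sqr_ge0.
Qed.

Variables (d d' : measure_display) (Y : measurableType d) (Xi : measurableType d').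
Variables (F : params -> Xi -> R) (gF : params -> Xi -> params).
Hypothesis F_grad : forall z, is_gradient (fun x => F x z) (fun x => gF x z).
Hypothesis F_meas : forall x, measurable_fun setT (F x).

(** Continuity in [x] is available for [F], which is differentiable, so the approximation by lattice
    points is applied to [F] and the gradient is recovered entry by entry. The space [Y] is
    arbitrary because it will be a product of [Xi] with a coarsened sample space. *)
Lemma measurable_stoch_grad (X : Y -> params) (z : Y -> Xi) :
  params_rv X -> measurable_fun setT z -> params_rv (fun y => gF (X y) (z y)).
Proof.
move=> mX mz l i j.
have mF (X' : Y -> params) : params_rv X' -> measurable_fun setT (fun y => F (X' y) (z y)).
  move=> mX'; apply: (@measurable_caratheodory _ _ _ _ _ _ (fun x y => F x (z y))) => //.
  - by move=> y; exact: gradient_pcontinuous (F_grad (z y)).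
  - by move=> x; exact: measurableT_comp.
pose e := pdelta i j.
apply: (@measurable_fun_cvg _ _ _ _ (fun k y =>
  k.+1%:R * (F (X y + k.+1%:R^-1 *: e) (z y) - F (X y) (z y)))).
  move=> k; apply: measurable_funM => //; apply: measurable_funB; last exact: mF.
  apply: mF => l' a b.
  have -> : (fun y => (X y + k.+1%:R^-1 *: e) l' a b) =
            (fun y => X y l' a b + (k.+1%:R^-1 *: e) l' a b).
    by apply/funext => y; rewrite mxE.
  exact: measurable_funD.
move=> y _; apply/cvgrPdist_le => eps eps0.
have N0 : 0 < 1 + pnorm e by rewrite ltr_pwDl// pnorm_ge0.
have [del del0 hdel] := F_grad (z y) (X y) (divr_gt0 eps0 N0).
near=> k.
have k0 : (0 : R) < k.+1%:R by rewrite ltr0n.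
have ki0 : (0 : R) < k.+1%:R^-1 by rewrite invr_gt0.
have kD : k.+1%:R^-1 < del / (1 + pnorm e).
  by near: k; exact: (near_infty_natSinv_lt (PosNum (divr_gt0 del0 N0))).
have ked : pnorm (k.+1%:R^-1 *: e) < del.
  rewrite pnormZ (gtr0_norm ki0).
  apply: le_lt_trans (_ : k.+1%:R^-1 * (1 + pnorm e) < _).
    by rewrite ler_pM2l// lerDr.
  by rewrite -ltr_pdivlMr.
have := hdel _ ked; rewrite pnormZ (gtr0_norm ki0) pinnerZr pinner_pdelta.
rewrite -[padd _ _]/(X y + k.+1%:R^-1 *: e) => hle.
set A := F _ _ - F _ _ in hle *.
rewrite distrC -[k.+1%:R * A - _](_ : k.+1%:R * (A - k.+1%:R^-1 * gF (X y) (z y) l i j) = _); last first.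
  by rewrite mulrBr mulrA divff ?gt_eqF// mul1r.
rewrite normrM (gtr0_norm k0) -ler_pdivlMl//; apply: le_trans hle _.
rewrite mulrCA ler_pM2l// mulrAC ler_pdivrMr// ler_pM2l// lerDr//.
Unshelve. all: by end_near. Qed.

Lemma measurable_lipschitz_grad (g : params -> params) (L : R) (X : Y -> params) :
  0 < L -> lipschitz_grad g L -> params_rv X -> params_rv (fun y => g (X y)).
Proof.
move=> L0 glip mX l i j.
apply: (@measurable_caratheodory _ _ _ _ _ _ (fun x _ => g x l i j)) => //.
by move=> _; exact: lipschitz_grad_pcontinuous glip.
Qed.
End gradient_measurability.

(** * Lifted momentum *)

Section layer_projection.
Variables (R : realType) (NL : nat) (m n r : 'I_NL -> nat).
Local Notation params := (params R m n).
Variables (P : forall l : 'I_NL, 'M[R]_(m l, r l)).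
Variables (Q : forall l : 'I_NL, 'M[R]_(n l, r l)).

Definition layer_proj (x : params) : params := fun l =>
  if (m l <= n l)%N then P l *m (P l)^T *m x l else x l *m (Q l *m (Q l)^T).

Lemma layer_proj_lin a u v :
  layer_proj (a *: u + v) = a *: layer_proj u + layer_proj v.
Proof.
apply: functional_extensionality_dep => l.
rewrite -[RHS]/(a *: layer_proj u l + layer_proj v l).
rewrite /layer_proj -[(a *: u + v) l]/(a *: u l + v l).
by case: ifP => _; rewrite ?mulmxDr ?mulmxDl -?scalemxAr -?scalemxAl.
Qed.

Lemma pinner_trace (u v : params) : pinner u v = \sum_(l < NL) \tr ((u l)^T *m v l).
Proof.
apply: eq_bigr => l _; rewrite exchange_big; apply: eq_bigr => j _.
by rewrite mxE; apply: eq_bigr => i _; rewrite mxE.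
Qed.

Lemma layer_proj_sym u v : pinner (layer_proj u) v = pinner u (layer_proj v).
Proof.
rewrite !pinner_trace; apply: eq_bigr => l _; rewrite /layer_proj.
case: ifP => _; rewrite !trmx_mul trmxK.
  by rewrite !mulmxA.
by rewrite -[X in \tr X = _]mulmxA mxtrace_mulC !mulmxA.
Qed.

Hypothesis PTP : forall l, (P l)^T *m P l = 1%:M.
Hypothesis QTQ : forall l, (Q l)^T *m Q l = 1%:M.

Lemma layer_proj_idem u : layer_proj (layer_proj u) = layer_proj u.
Proof.
apply: functional_extensionality_dep => l; rewrite /layer_proj.
case: ifP => mn.
  by rewrite mn !mulmxA -(mulmxA (P l) (P l)^T (P l)) PTP mulmx1.
by rewrite mn -!mulmxA (mulmxA (Q l)^T (Q l)) QTQ mul1mx.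
Qed.

End layer_projection.

Section lifted_momentum.
Variables (R : realType) (NL : nat) (m n r : 'I_NL -> nat).
Local Notation params := (params R m n).
Variables (x0 : params) (G : nat -> params -> params).
Variables (Ps : nat -> forall l : 'I_NL, 'M[R]_(m l, r l)).
Variables (Qs : nat -> forall l : 'I_NL, 'M[R]_(n l, r l)).
Variables (beta eta : R) (tau : nat).

Local Notation state := (golore_state x0 G Ps Qs beta eta tau).
Local Notation x := (golore_x x0 G Ps Qs beta eta tau).

(** The momentum stored in [state t] was computed at step [t - 1] and lives in the coordinates of
    that step's projection, hence the index [t.-1]. At [t = 0] the momentum is zero and the index is
    immaterial. *)
Definition golore_lift t : params := fun l =>
  if (m l <= n l)%N then Ps (t.-1 %/ tau)%N l *m gML (state t) l
  else gMR (state t) l *m (Qs (t.-1 %/ tau)%N l)^T.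

Lemma golore_lift0 : golore_lift 0 = 0.
Proof.
apply: functional_extensionality_dep => l.
by rewrite /golore_lift; case: ifP => _; rewrite ?mulmx0 ?mul0mx.
Qed.

Lemma golore_xS t : x t.+1 = x t - eta *: golore_lift t.+1.
Proof.
apply: functional_extensionality_dep => l.
rewrite -[RHS]/(x t l - eta *: golore_lift t.+1 l) /golore_lift.
by rewrite [LHS]/golore_x /=; case: ifP.
Qed.

(** The correction factor of the algorithm, new projection transposed times old projection, becomes
    the new orthogonal projection applied to the lifted momentum. One formula thus covers steps with
    and without a refresh. *)
Lemma golore_liftS t : golore_lift t.+1 =
  layer_proj (Ps (t %/ tau)%N) (Qs (t %/ tau)%N)
    ((1 - beta) *: golore_lift t + beta *: G t (x t)).
Proof.
apply: functional_extensionality_dep => l.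
set z := (X in layer_proj _ _ X).
have zE : z l = (1 - beta) *: golore_lift t l + beta *: G t (x t) l by [].
rewrite /layer_proj zE /golore_lift /=; case: ifP => _.
  by rewrite !mulmxDr -!scalemxAr !mulmxA.
by rewrite !mulmxDl -!scalemxAl !mulmxA.
Qed.

End lifted_momentum.

(** * Measurability of the iterates in the samples already drawn *)

Section matrix_rv.
Variables (R : realType) (d : measure_display) (Y : measurableType d).

Lemma mx_rv_add a b (A B : Y -> 'M[R]_(a, b)) : mx_rv A -> mx_rv B ->
  mx_rv (fun y => A y + B y).
Proof.
move=> mA mB i j; under eq_fun do rewrite mxE.
exact: measurable_funD.
Qed.

Lemma mx_rv_scale a b c (A : Y -> 'M[R]_(a, b)) : mx_rv A ->
  mx_rv (fun y => c *: A y).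
Proof.
move=> mA i j; under eq_fun do rewrite mxE.
exact: measurable_funM.
Qed.

Lemma mx_rv_sub a b (A B : Y -> 'M[R]_(a, b)) : mx_rv A -> mx_rv B ->
  mx_rv (fun y => A y - B y).
Proof.
move=> mA mB i j; under eq_fun do rewrite !mxE.
exact: measurable_funB.
Qed.

Lemma mx_rv_tr a b (A : Y -> 'M[R]_(a, b)) : mx_rv A -> mx_rv (fun y => (A y)^T).
Proof. by move=> mA i j; under eq_fun do rewrite mxE; exact: mA. Qed.

Lemma mx_rv_mul a b c (A : Y -> 'M[R]_(a, b)) (B : Y -> 'M[R]_(b, c)) :
  mx_rv A -> mx_rv B -> mx_rv (fun y => A y *m B y).
Proof.
move=> mA mB i j; under eq_fun do rewrite mxE.
by apply: measurable_sum => k; exact: measurable_funM.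
Qed.

End matrix_rv.

Section params_rv.
Variables (R : realType) (NL : nat) (m n r : 'I_NL -> nat).
Local Notation params := (params R m n).
Variables (d : measure_display) (Y : measurableType d).
Implicit Types U V : Y -> params.

Lemma params_rvD U V : params_rv U -> params_rv V -> params_rv (fun y => U y + V y).
Proof. by move=> mU mV l; exact: mx_rv_add. Qed.

Lemma params_rvB U V : params_rv U -> params_rv V -> params_rv (fun y => U y - V y).
Proof. by move=> mU mV l; exact: mx_rv_sub. Qed.

Lemma params_rvZ c U : params_rv U -> params_rv (fun y => c *: U y).
Proof. by move=> mU l; exact: mx_rv_scale. Qed.

Lemma measurable_pinner U V : params_rv U -> params_rv V ->
  measurable_fun setT (fun y => pinner (U y) (V y)).
Proof.
move=> mU mV; do 3 apply: measurable_sum => ?.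
exact: measurable_funM.
Qed.

Lemma params_rv_proj U (P : forall l, Y -> 'M[R]_(m l, r l))
    (Q : forall l, Y -> 'M[R]_(n l, r l)) :
  (forall l, mx_rv (P l)) -> (forall l, mx_rv (Q l)) -> params_rv U ->
  params_rv (fun y => layer_proj (P^~ y) (Q^~ y) (U y)).
Proof.
move=> mP mQ mU l; rewrite /layer_proj.
case: (boolP (m l <= n l)%N) => _;
by repeat first [exact: mP|exact: mQ|exact: mU|apply: mx_rv_mul|apply: mx_rv_tr].
Qed.

Variables (d' : measure_display) (Xi : measurableType d').
Variables (x0 : params) (gF : params -> Xi -> params) (xi : nat -> Y -> Xi).
Variables (Pm : nat -> forall l : 'I_NL, Y -> 'M[R]_(m l, r l)).
Variables (Qm : nat -> forall l : 'I_NL, Y -> 'M[R]_(n l, r l)).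
Variables (beta eta : R) (tau : nat).
Hypothesis gF_rv : forall (X : Y -> params) (z : Y -> Xi),
  params_rv X -> measurable_fun setT z -> params_rv (fun y => gF (X y) (z y)).

Let state t y := golore_state x0 (fun s x => gF x (xi s y))
  (fun k l => Pm k l y) (fun k l => Qm k l y) beta eta tau t.

(** Only the samples used before step [t] are assumed measurable: [xi s] with [s < t], and the
    projections of index [k] with [k * tau < t]. The lemma therefore also applies over
    sigma-algebras from which a later source has been removed. *)
Lemma golore_state_rv t :
  (forall s, (s < t)%N -> measurable_fun setT (xi s)) ->
  (forall k l, (k * tau < t)%N -> mx_rv (Pm k l)) ->
  (forall k l, (k * tau < t)%N -> mx_rv (Qm k l)) ->
  [/\ params_rv (fun y => gx (state t y)),
      forall l, mx_rv (fun y => gML (state t y) l) &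
      forall l, mx_rv (fun y => gMR (state t y) l)].
Proof.
elim: t => [|t IH] mxi mP mQ.
  by split => [l i j|l i j|l i j]; exact: measurable_cst.
have [] := IH.
- by move=> s st; apply: mxi; exact: ltnW.
- by move=> k l kt; apply: mP; exact: ltnW.
- by move=> k l kt; apply: mQ; exact: ltnW.
move=> mx mML mMR.
have kt (s : nat) : (s <= t)%N -> (s %/ tau * tau < t.+1)%N.
  by move=> st; rewrite ltnS (leq_trans (leq_trunc_div _ _)).
have mP0 l := mP _ l (kt t (leqnn t)); have mP1 l := mP _ l (kt t.-1 (leq_pred t)).
have mQ0 l := mQ _ l (kt t (leqnn t)); have mQ1 l := mQ _ l (kt t.-1 (leq_pred t)).
have mG := gF_rv mx (mxi t (ltnSn t)).
have mGl l : mx_rv (fun y => gF (gx (state t y)) (xi t y) l) by exact: mG.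
have mML' l : mx_rv (fun y => gML (state t.+1 y) l).
  apply: mx_rv_add; apply: mx_rv_scale; apply: mx_rv_mul.
  - by apply: mx_rv_mul; [exact/mx_rv_tr/mP0|exact: mP1].
  - exact: mML.
  - exact/mx_rv_tr/mP0.
  - exact: mGl.
have mMR' l : mx_rv (fun y => gMR (state t.+1 y) l).
  apply: mx_rv_add; apply: mx_rv_scale; apply: mx_rv_mul.
  - by apply: mx_rv_mul; [exact: mMR|exact/mx_rv_tr/mQ1].
  - exact: mQ0.
  - exact: mGl.
  - exact: mQ0.
split => // l /=; case: (boolP (m l <= n l)%N) => _.
- apply: mx_rv_sub; first exact: mx.
  by apply: mx_rv_scale; apply: mx_rv_mul => //; exact: mML'.
- apply: mx_rv_sub; first exact: mx.
  by apply: mx_rv_scale; apply: mx_rv_mul; [exact: mMR'|exact: mx_rv_tr].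
Qed.

Lemma golore_x_rv t :
  (forall s, (s < t)%N -> measurable_fun setT (xi s)) ->
  (forall k l, (k * tau < t)%N -> mx_rv (Pm k l)) ->
  (forall k l, (k * tau < t)%N -> mx_rv (Qm k l)) ->
  params_rv (fun y => golore_x x0 (fun s x => gF x (xi s y))
    (fun k l => Pm k l y) (fun k l => Qm k l y) beta eta tau t).
Proof. by move=> mxi mP mQ; case: (golore_state_rv mxi mP mQ). Qed.

Lemma golore_lift_rv t :
  (forall s, (s < t)%N -> measurable_fun setT (xi s)) ->
  (forall k l, (k * tau < t)%N -> mx_rv (Pm k l)) ->
  (forall k l, (k * tau < t)%N -> mx_rv (Qm k l)) ->
  params_rv (fun y => golore_lift x0 (fun s x => gF x (xi s y))
    (fun k l => Pm k l y) (fun k l => Qm k l y) beta eta tau t).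
Proof.
case: t => [|t] mxi mP mQ.
  by move=> l i j; under eq_fun do rewrite golore_lift0; exact: measurable_cst.
have [_ mML mMR] := golore_state_rv mxi mP mQ.
have kt : (t %/ tau * tau < t.+1)%N by rewrite ltnS leq_trunc_div.
move=> l; rewrite /golore_lift /=; case: (boolP (m l <= n l)%N) => _; apply: mx_rv_mul.
- exact: mP.
- exact: mML.
- exact: mMR.
- by apply: mx_rv_tr; exact: mQ.
Qed.

End params_rv.

(** * Mean of a uniformly distributed projection *)

Section Rintegral_sum.
Variables (R : realType) (d : measure_display) (T : measurableType d).
Variable mu : {measure set T -> \bar R}.

Lemma integrable_EFin_sum (I : Type) (s : seq I) (F : I -> T -> R) :
  (forall i, mu.-integrable setT (EFin \o F i)) ->
  mu.-integrable setT (EFin \o (fun w => \sum_(i <- s) F i w)).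
Proof.
move=> iF; elim: s => [|i s IH].
  by under eq_fun do rewrite big_nil; exact: integrable0.
under eq_fun do rewrite big_cons.
exact: (integrableD measurableT (iF i) IH).
Qed.

Lemma Rintegral_sum (I : Type) (s : seq I) (F : I -> T -> R) :
  (forall i, mu.-integrable setT (EFin \o F i)) ->
  \int[mu]_w (\sum_(i <- s) F i w) = \sum_(i <- s) \int[mu]_w F i w.
Proof.
move=> iF; elim: s => [|i s IH].
  rewrite big_nil; under eq_Rintegral do rewrite big_nil.
  by rewrite /Rintegral integral0.
rewrite big_cons -IH; under eq_Rintegral do rewrite big_cons.
by rewrite RintegralD//; exact: integrable_EFin_sum.
Qed.

End Rintegral_sum.

Section clip.
Variable R : realType.

(** Test functions for the uniform law must be bounded and Lipschitz on all matrices, which products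
    of entries are not. Stiefel matrices have entries in [[-1, 1]], where clipping changes
    nothing. *)
Definition clip (t : R) : R := Num.max (- 1) (Num.min t 1).

Lemma clip_id t : `|t| <= 1 -> clip t = t.
Proof.
by rewrite ler_norml => /andP[h1 h2]; rewrite /clip (min_idPl h2) (max_idPr h1).
Qed.

Lemma norm_clip_le1 t : `|clip t| <= 1.
Proof.
rewrite ler_norml /clip le_max lexx /= ge_max ge_min lexx orbT andbT; lra.
Qed.

Lemma clip_lip s t : `|clip s - clip t| <= `|s - t|.
Proof.
rewrite /clip; case: (leP s 1) => ?; case: (leP t 1) => ?.
- case: (leP (-1) s) => ?; case: (leP (-1) t) => ?; rewrite ler_norml;
  case: (ler0P (s - t)) => ?; lra.
- case: (leP (-1) s) => ?; case: (leP (-1) (1 : R)) => ?; rewrite ler_norml;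
  case: (ler0P (s - t)) => ?; lra.
- case: (leP (-1) t) => ?; case: (leP (-1) (1 : R)) => ?; rewrite ler_norml;
  case: (ler0P (s - t)) => ?; lra.
- by rewrite subrr normr0.
Qed.

End clip.

Section uniform_stiefel_projection.
Variables (R : realType) (d : measure_display) (Om : measurableType d).
Variable P : probability Om R.

Lemma entry_le_frob2 a b (A : 'M[R]_(a, b)) i j : A i j ^+ 2 <= frob2 A.
Proof.
rewrite /frob2 (bigD1 i)//= (bigD1 j)//= -addrA lerDl addr_ge0//.
  by apply: sumr_ge0 => ? _; rewrite sqr_ge0.
by do 2 apply: sumr_ge0 => ? _; rewrite sqr_ge0.
Qed.

Lemma stiefel_entry_le1 a b (A : 'M[R]_(a, b)) i k :
  A^T *m A = 1%:M -> `|A i k| <= 1.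
Proof.
move=> /matrixP/(_ k k); rewrite !mxE eqxx => h.
rewrite -(@expr_le1 _ 2)// real_normK ?num_real// -[leRHS]/(1%:R) -h (bigD1 i)//=.
rewrite !mxE -expr2 lerDl; apply: sumr_ge0 => j _.
by rewrite !mxE -expr2 sqr_ge0.
Qed.

(* A bounded Lipschitz function equal to (A A^T) i j on the Stiefel manifold. *)
Let gram a b (i j : 'I_a) (A : 'M[R]_(a, b)) : R :=
  \sum_(k < b) clip (A i k) * clip (A j k).

Let gramE a b (i j : 'I_a) (A : 'M[R]_(a, b)) : A^T *m A = 1%:M ->
  gram i j A = (A *m A^T) i j.
Proof.
move=> hA; rewrite mxE; apply: eq_bigr => k _.
by rewrite mxE !clip_id//; exact: stiefel_entry_le1.
Qed.

Let gram_bdd_lip a b (i j : 'I_a) : bdd_lip_mx (@gram a b i j).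
Proof.
exists (2 * b%:R) => A B; split.
  apply: le_trans (ler_norm_sum _ _ _) _.
  apply: (@le_trans _ _ (\sum_(k < b) 1)).
    apply: ler_sum => k _; rewrite normrM.
    by rewrite mulr_ile1// norm_clip_le1.
  by rewrite sumr_const card_ord ler_peMl ?ler0n// ler1n.
rewrite /gram -sumrB; apply: le_trans (ler_norm_sum _ _ _) _.
rewrite mulrAC mulr_natr -[X in _ *+ X]card_ord -sumr_const; apply: ler_sum => k _.
have e (s : 'I_a) : `|A s k - B s k| <= Num.sqrt (frob2 (A - B)).
  rewrite -sqrtr_sqr ler_sqrt; last exact: (le_trans (sqr_ge0 _) (entry_le_frob2 _ s k)).
  by have := entry_le_frob2 (A - B) s k; rewrite !mxE.
have -> : clip (A i k) * clip (A j k) - clip (B i k) * clip (B j k) =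
  clip (A i k) * (clip (A j k) - clip (B j k)) +
  (clip (A i k) - clip (B i k)) * clip (B j k) by ring.
apply: le_trans (ler_normD _ _) _; rewrite [leRHS]mulr_natl mulr2n; apply: lerD; rewrite normrM.
  apply: le_trans (_ : 1 * `|A j k - B j k| <= _); last by rewrite mul1r.
  by apply: ler_pM => //; [exact: norm_clip_le1|exact: clip_lip].
apply: le_trans (_ : `|A i k - B i k| * 1 <= _); last by rewrite mulr1.
by apply: ler_pM => //; [exact: clip_lip|exact: norm_clip_le1].
Qed.

Variables (a b : nat) (M : Om -> 'M[R]_(a, b)).
Hypothesis M_unif : uniform_stiefel P M.

Let MTM w : (M w)^T *m M w = 1%:M. Proof. by case: M_unif. Qed.

Let gram_entry w i j : `|(M w *m (M w)^T) i j| <= b%:R.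
Proof.
rewrite mxE; apply: le_trans (ler_norm_sum _ _ _) _.
rewrite -[X in _ <= X%:R]card_ord -sumr_const; apply: ler_sum => k _.
by rewrite normrM mulr_ile1// ?mxE; exact: stiefel_entry_le1.
Qed.

Let gram_integrable i j :
  P.-integrable setT (EFin \o (fun w => (M w *m (M w)^T) i j)).
Proof.
apply: measurable_bounded_integrable => //.
- by rewrite -ge0_fin_numE// fin_num_measure.
- by case: M_unif => _ mM _; exact: (mx_rv_mul mM (mx_rv_tr mM)).
- exists b%:R; split; first exact: num_real.
  by move=> y by_ w _; exact: le_trans (gram_entry w i j) (ltW by_).
Qed.

Let invariance U i j : U^T *m U = 1%:M ->
  \int[P]_w ((U *m M w *m (U *m M w)^T) i j) = \int[P]_w ((M w *m (M w)^T) i j).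
Proof.
move=> hU; have [_ _ /(_ U hU _ (gram_bdd_lip b i j)) h] := M_unif.
transitivity (\int[P]_w gram i j (U *m M w)).
  apply: eq_Rintegral => w _; rewrite gramE// trmx_mul -mulmxA (mulmxA _ U) hU.
  by rewrite mul1mx MTM.
by rewrite h; apply: eq_Rintegral => w _; rewrite gramE.
Qed.

Let gram_diag i j :
  \int[P]_w ((M w *m (M w)^T) i i) = \int[P]_w ((M w *m (M w)^T) j j).
Proof.
rewrite -(@invariance (perm_mx (tperm i j)) i i).
  apply: eq_Rintegral => w _; rewrite -row_permE !mxE.
  by apply: eq_bigr => k _; rewrite !mxE tpermL.
by rewrite tr_perm_mx -perm_mxM mulVg perm_mx1.
Qed.

Let gram_offdiag i j : i != j -> \int[P]_w ((M w *m (M w)^T) i j) = 0.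
Proof.
move=> ij; pose U : 'M[R]_a := diag_mx (\row_k (-1) ^+ (k == i)).
have UMi w k : (U *m M w) i k = - M w i k.
  by rewrite mul_diag_mx !mxE eqxx mulN1r.
have UMj w k : (U *m M w) j k = M w j k.
  by rewrite mul_diag_mx !mxE eq_sym (negPf ij) mul1r.
have UTU : U^T *m U = 1%:M.
  rewrite tr_diag_mx mulmx_diag; apply/matrixP => k l; rewrite !mxE.
  by rewrite -expr2 sqrr_sign.
have := invariance i j UTU.
have -> : \int[P]_w ((U *m M w *m (U *m M w)^T) i j) =
    - \int[P]_w ((M w *m (M w)^T) i j).
  rewrite -mulN1r -RintegralZl//; apply: eq_Rintegral => w _.
  rewrite [LHS]mxE mulN1r mxE -sumrN; apply: eq_bigr => k _.
  by rewrite [(U *m M w)^T k j]mxE UMi UMj mulNr [(M w)^T k j]mxE.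
lra.
Qed.

(** Invariance is used for two kinds of orthogonal matrices only: transpositions equalise the
    diagonal entries, and a sign change of one coordinate kills those off the diagonal. The trace of
    [M M^T] is always [b], which fixes the common value. *)
Lemma uniform_stiefel_gram i j :
  \int[P]_w ((M w *m (M w)^T) i j) = b%:R / a%:R * (i == j)%:R.
Proof.
have [<-|ij] := eqVneq i j; last by rewrite mulr0 gram_offdiag.
have a0 : a%:R != 0 :> R by rewrite pnatr_eq0 -lt0n (leq_trans _ (ltn_ord i)).
rewrite mulr1; apply: (mulIf a0); rewrite divfK//.
have <- : \sum_(k < a) \int[P]_w ((M w *m (M w)^T) k k) = b%:R.
  rewrite -Rintegral_sum//.
  transitivity (\int[P]_w (b%:R : R)).
    apply: eq_Rintegral => w _; rewrite -[LHS]/(\tr (M w *m (M w)^T)) mxtrace_mulC MTM.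
    by rewrite mxtrace1.
  by rewrite Rintegral_cst// [X in _ * fine X](probability_setT P) mulr1.
rewrite (eq_bigr (fun=> \int[P]_w ((M w *m (M w)^T) i i))); last by move=> k _; exact: gram_diag.
by rewrite sumr_const card_ord mulr_natr.
Qed.

(** Idempotence makes the squared norm linear in the entries of [A A^T], so its expectation needs
    only their means. *)
Lemma frob2_proj c (A : 'M[R]_(a, b)) (x : 'M[R]_(a, c)) : A^T *m A = 1%:M ->
  frob2 (A *m A^T *m x) =
  \sum_(j < c) \sum_(i < a) \sum_(k < a) x i j * x k j * (A *m A^T) i k.
Proof.
move=> hA; have -> : frob2 (A *m A^T *m x) = \tr (x^T *m (A *m A^T *m x)).
  have -> : x^T *m (A *m A^T *m x) = (A *m A^T *m x)^T *m (A *m A^T *m x).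
    by rewrite !trmx_mul trmxK !mulmxA -(mulmxA _ A^T A) hA mulmx1.
  rewrite /frob2 exchange_big; apply: eq_bigr => j _.
  by rewrite mxE; apply: eq_bigr => i _; rewrite [X in _ = X * _]mxE expr2.
apply: eq_bigr => j _; rewrite mxE; apply: eq_bigr => i _.
rewrite mxE [in LHS]mxE mulr_sumr; apply: eq_bigr => k _; ring.
Qed.

Lemma uniform_stiefel_frob2 c (x : 'M[R]_(a, c)) :
  (\int[P]_w (frob2 (M w *m (M w)^T *m x))%:E = (b%:R / a%:R * frob2 x)%:E)%E.
Proof.
have iq j i k : P.-integrable setT
    (EFin \o (fun w => x i j * x k j * (M w *m (M w)^T) i k)).
  exact: (integrableZl measurableT _ (gram_integrable i k)).
have iqs : P.-integrable setT (EFin \o (fun w => frob2 (M w *m (M w)^T *m x))).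
  under eq_fun do rewrite frob2_proj//.
  by do 3 apply: integrable_EFin_sum => ?.
rewrite -[LHS]fineK ?integrable_fin_num//; congr (_%:E).
rewrite -[LHS]/(\int[P]_w (frob2 (M w *m (M w)^T *m x))).
under eq_Rintegral do rewrite frob2_proj//.
rewrite Rintegral_sum => [|j]; last by do 2 apply: integrable_EFin_sum => ?.
rewrite /frob2 exchange_big /= mulr_sumr; apply: eq_bigr => j _.
rewrite Rintegral_sum => [|i]; last by apply: integrable_EFin_sum => ?.
rewrite mulr_sumr; apply: eq_bigr => i _; rewrite Rintegral_sum//.
rewrite (bigD1 i)//= RintegralZl// uniform_stiefel_gram eqxx mulr1.
rewrite big1 ?addr0 => [|k ki]; first by rewrite mulrC expr2.
by rewrite RintegralZl// uniform_stiefel_gram eq_sym (negPf ki) !mulr0.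
Qed.

End uniform_stiefel_projection.

(** * Expectations along the trajectory *)

Section square_integrable.
Variables (R : realType) (NL : nat) (m n : 'I_NL -> nat).
Local Notation params := (params R m n).
Variables (d : measure_display) (Om : measurableType d) (P : probability Om R).
Implicit Types U V : Om -> params.

Definition sqint U := params_rv U /\
  P.-integrable setT (EFin \o (fun w => psqnorm (U w))).

Lemma psqnorm_ge0 (x : params) : 0 <= psqnorm x.
Proof. by rewrite psqnormE pinner_ge0. Qed.

Lemma measurable_psqnorm (d' : measure_display) (Y : measurableType d')
    (U : Y -> params) : params_rv U -> measurable_fun setT (fun w => psqnorm (U w)).
Proof. by move=> mU; under eq_fun do rewrite psqnormE; exact: measurable_pinner. Qed.

Lemma integrable_EFin_cst (c : R) : P.-integrable setT (EFin \o (fun _ : Om => c)).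
Proof. by apply: finite_measure_integrable_cst. Qed.

Lemma integrable_EFinD (f g : Om -> R) : P.-integrable setT (EFin \o f) ->
  P.-integrable setT (EFin \o g) -> P.-integrable setT (EFin \o (fun w => f w + g w)).
Proof. by move=> fi gi; exact: (integrableD measurableT fi gi). Qed.

Lemma integrable_EFinZ (c : R) (f : Om -> R) : P.-integrable setT (EFin \o f) ->
  P.-integrable setT (EFin \o (fun w => c * f w)).
Proof. by move=> fi; exact: (integrableZl measurableT c fi). Qed.

Lemma le_sqint U (g : Om -> R) : params_rv U ->
  P.-integrable setT (EFin \o g) -> (forall w, psqnorm (U w) <= g w) -> sqint U.
Proof.
move=> mU gi Ug; split => //; apply: le_integrable gi => //.
  by apply/measurable_EFinP; exact: measurable_psqnorm.
move=> w _ /=; rewrite lee_fin ger0_norm ?psqnorm_ge0//.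
exact: le_trans (Ug w) (ler_norm _).
Qed.

Lemma sqint_cst (x : params) : sqint (fun=> x).
Proof. by split; [move=> l i j|exact: integrable_EFin_cst]. Qed.

Lemma sqintZ c U : sqint U -> sqint (fun w => c *: U w).
Proof.
move=> [mU iU]; split; first exact: params_rvZ.
under eq_fun do rewrite psqnormZ.
exact: integrable_EFinZ.
Qed.

Lemma sqintD U V : sqint U -> sqint V -> sqint (fun w => U w + V w).
Proof.
move=> [mU iU] [mV iV].
apply: (@le_sqint _ (fun w => 2 * psqnorm (U w) + 2 * psqnorm (V w))).
- exact: params_rvD.
- by apply: integrable_EFinD; exact: integrable_EFinZ.
- by move=> w; exact: psqnormD_le2.
Qed.

Lemma sqintB U V : sqint U -> sqint V -> sqint (fun w => U w - V w).
Proof.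
move=> hU hV; under eq_fun do rewrite -scaleN1r.
by apply: sqintD => //; exact: sqintZ.
Qed.

Lemma integrable_pinner U V : sqint U -> sqint V ->
  P.-integrable setT (EFin \o (fun w => pinner (U w) (V w))).
Proof.
move=> [mU iU] [mV iV].
apply: (@le_integrable _ _ _ _ _ measurableT _
    (EFin \o (fun w => psqnorm (U w) + psqnorm (V w)))).
- by apply/measurable_EFinP; exact: measurable_pinner.
- move=> w _ /=; rewrite lee_fin [leRHS]ger0_norm ?addr_ge0 ?psqnorm_ge0//.
  have := pinner_young (U w) (V w) ltr01.
  have := pinner_young (U w) (- V w) ltr01.
  have := pinner_ge0 (U w); have := pinner_ge0 (V w).
  rewrite !pinnerNr pinnerNl opprK invr1 !mul1r !psqnormE => *.
  by rewrite ler_norml; apply/andP; split; lra.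
- exact: integrable_EFinD.
Qed.

Lemma sqint_lipschitz (g : params -> params) (L : R) U : 0 < L ->
  lipschitz_grad g L -> sqint U -> sqint (fun w => g (U w)).
Proof.
move=> L0 glip hU; have [mU _] := hU.
have [_ i1] := sqintB hU (sqint_cst 0).
apply: (@le_sqint _ (fun w => 2 * psqnorm (g 0) + 2 * (L ^+ 2 * psqnorm (U w - 0)))).
- exact: measurable_lipschitz_grad glip mU.
- apply: integrable_EFinD; first exact: integrable_EFin_cst.
  by do 2 apply: integrable_EFinZ.
- move=> w; rewrite -{1}(subrK (g 0) (g (U w))) addrC.
  apply: le_trans (psqnormD_le2 _ _) _; rewrite lerD2l ler_pM2l//.
  by rewrite !psqnormE; exact: lipschitz_grad_sq.
Qed.

End square_integrable.

(** * The sampling sources and integration against one of them *)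

Section sampling_sigma_algebras.
Variables (R : realType) (NL : nat) (m n r : 'I_NL -> nat).
Variables (d d' : measure_display) (Om : measurableType d) (Xi : measurableType d').
Variable P : probability Om R.
Variables (xi : nat -> Om -> Xi).
Variables (Pm : nat -> forall l : 'I_NL, Om -> 'M[R]_(m l, r l)).
Variables (Qm : nat -> forall l : 'I_NL, Om -> 'M[R]_(n l, r l)).
Hypothesis mxi : forall t, measurable_fun setT (xi t).
Hypothesis mPm : forall k l, mx_rv (Pm k l).
Hypothesis mQm : forall k l, mx_rv (Qm k l).
Hypothesis indep : mutual_indep P (golore_sigmas xi Pm Qm).

Local Notation index := (nat + (nat * 'I_NL * bool))%type.
Local Notation sigmas := (golore_sigmas xi Pm Qm).

(* All the sampling events except those of source [i]. *)
Definition sigma_others (i : index) := \bigcup_(j in [set j | j != i]) sigmas j.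

(** A copy of [Om] with a coarser sigma-algebra: measurability from it expresses being determined by
    the sources other than [i]. *)
Definition others (i : index) : Type := g_sigma_algebraType (sigma_others i).

HB.instance Definition _ i := Measurable.on (others i).

Lemma mx_sigma_measurable a b (M : Om -> 'M[R]_(a, b)) :
  mx_rv M -> mx_sigma M `<=` measurable.
Proof.
move=> mM; apply: smallest_sub; first exact: sigma_algebra_measurable.
move=> _ [i [j [B [mB ->]]]]; rewrite -[X in measurable X]setTI.
exact: mM.
Qed.

Lemma golore_sigmas_sigma_algebra i : sigma_algebra setT (sigmas i).
Proof.
case: i => [t|[[k l] []]] /=; try exact: smallest_sigma_algebra.
have := sigma_algebra_preimage setT (xi t) (@sigma_algebra_measurable _ Xi).
suff -> : preimage_set_system setT (xi t) measurable = rv_sigma (xi t) by [].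
by apply/seteqP; split => _ [B mB <-]; exists B; rewrite ?setTI.
Qed.

Lemma golore_sigmas_measurable i : sigmas i `<=` measurable.
Proof.
case: i => [t|[[k l] []]] /=; try exact: mx_sigma_measurable.
by move=> _ [B mB <-]; rewrite -[X in measurable X]setTI; exact: mxi.
Qed.

Lemma measurable_others i (A : set (others i)) : measurable A ->
  measurable (A : set Om).
Proof.
apply: smallest_sub; first exact: sigma_algebra_measurable.
by move=> B [j _]; exact: golore_sigmas_measurable.
Qed.

Lemma measurable_to_others i : measurable_fun setT (fun w : Om => w : others i).
Proof. by move=> _ A mA; rewrite setTI; exact: (@measurable_others i A mA). Qed.

Lemma others_xi i t : inl t != i -> measurable_fun setT (xi t : others i -> Xi).
Proof.
move=> ti _ B mB; rewrite setTI; apply: sub_sigma_algebra.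
by exists (inl t) => //=; exists B.
Qed.

Lemma others_Pm i k l : inr (k, l, true) != i -> mx_rv (Pm k l : others i -> _).
Proof.
move=> ti a b _ B mB; rewrite setTI; apply: sub_sigma_algebra.
by exists (inr (k, l, true)) => //=; apply: sub_sigma_algebra; exists a, b, B.
Qed.

Lemma others_Qm i k l : inr (k, l, false) != i -> mx_rv (Qm k l : others i -> _).
Proof.
move=> ti a b _ B mB; rewrite setTI; apply: sub_sigma_algebra.
by exists (inr (k, l, false)) => //=; apply: sub_sigma_algebra; exists a, b, B.
Qed.

Lemma indep_others i (A : set (others i)) (B : set Om) : measurable A ->
  sigmas i B -> P ((A : set Om) `&` B) = (P (A : set Om) * P B)%E.
Proof.
move=> mA sB; apply: (mutual_indep_others _ _ indep mA sB).
- exact: golore_sigmas_sigma_algebra.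
- exact: golore_sigmas_measurable.
Qed.

Section xi_conditioning.
Variable D : probability Xi R.
Hypothesis xi_law : forall t B, measurable B -> P (xi t @^-1` B) = D B.

Let to_others i : {RV P >-> others i} :=
  HB.pack (fun w : Om => w : others i) (isMeasurableFun.Build _ _ _ _ _ (@measurable_to_others i)).
Let xi_rv t : {RV P >-> Xi} := HB.pack (xi t) (isMeasurableFun.Build _ _ _ _ _ (mxi t)).

Let indep_xi t A B : measurable A -> measurable B ->
  P (to_others (inl t) @^-1` A `&` xi_rv t @^-1` B) =
  (P (to_others (inl t) @^-1` A) * P (xi_rv t @^-1` B))%E.
Proof. by move=> mA mB; apply: (indep_others mA); exists B. Qed.

Let xi_integral t (h : Xi -> \bar R) :
  (\int[distribution P (xi_rv t)]_z h z = \int[D]_z h z)%E.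
Proof. by apply: eq_measure_integral => A mA _; exact: xi_law. Qed.

Lemma xi_tonelli t (h : Om -> Xi -> \bar R) :
  measurable_fun [set: others (inl t) * Xi] (fun wz => h wz.1 wz.2) ->
  (forall w z, 0 <= h w z)%E ->
  (\int[P]_w h w (xi t w) = \int[P]_w \int[D]_z h w z)%E.
Proof.
move=> mh h0.
rewrite (indep_tonelli (@indep_xi t) mh) => [|[w z]]; last exact: h0.
by apply: eq_integral => w _; exact: xi_integral.
Qed.

Lemma xi_fubini t (h : Om -> Xi -> \bar R) :
  measurable_fun [set: others (inl t) * Xi] (fun wz => h wz.1 wz.2) ->
  P.-integrable setT (fun w => h w (xi t w)) ->
  (\int[P]_w h w (xi t w) = \int[P]_w \int[D]_z h w z)%E.
Proof.
move=> mh ih.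
rewrite (indep_fubini (@indep_xi t) mh)//.
by apply: eq_integral => w _; exact: xi_integral.
Qed.

End xi_conditioning.

Section mx_conditioning.
Variables (a b : nat) (M : Om -> 'M[R]_(a, b)) (i : index).
Hypothesis mM : mx_rv M.
Hypothesis iM : sigmas i = mx_sigma M.

(** A second copy of [Om], with the events determined by the entries of [M]. The integrand of
    [mx_tonelli] is then a function of two sample points, one for the past and one for the fresh
    matrix. *)
Definition mx_gen : Type := g_sigma_algebraType
  [set E | exists i j (B : set R), measurable B /\ E = (fun w => M w i j) @^-1` B].

HB.instance Definition _ := Measurable.on mx_gen.

Lemma mx_gen_rv : mx_rv (M : mx_gen -> _).
Proof.
by move=> i0 j0 _ B mB; rewrite setTI; apply: sub_sigma_algebra; exists i0, j0, B.
Qed.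

Let measurable_to_mx_gen : measurable_fun setT (fun w : Om => w : mx_gen).
Proof. by move=> _ A mA; rewrite setTI; exact: (mx_sigma_measurable mM). Qed.

Let to_others : {RV P >-> others i} :=
  HB.pack (fun w : Om => w : others i) (isMeasurableFun.Build _ _ _ _ _ (@measurable_to_others i)).
Let to_mx : {RV P >-> mx_gen} := HB.pack (fun w : Om => w : mx_gen)
  (isMeasurableFun.Build _ _ _ _ _ measurable_to_mx_gen).

Lemma mx_tonelli (h : Om -> Om -> \bar R) :
  measurable_fun [set: others i * mx_gen] (fun ww => h ww.1 ww.2) ->
  (forall w w', 0 <= h w w')%E ->
  (\int[P]_w h w w = \int[P]_w \int[P]_w' h w w')%E.
Proof.
move=> mh h0.
have indepM A B : measurable A -> measurable B ->
    P (to_others @^-1` A `&` to_mx @^-1` B) =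
    (P (to_others @^-1` A) * P (to_mx @^-1` B))%E.
  by move=> mA mB; apply: (indep_others mA); rewrite iM.
have := indep_tonelli indepM mh; rewrite /= => -> => [|[w w']]; last exact: h0.
apply: eq_integral => w _.
rewrite (@ge0_integral_distribution _ _ _ _ _ _ to_mx)//.
exact: (measurableT_comp mh (measurable_fun_pair (measurable_cst _) (@measurable_id _ _ _))).
Qed.

End mx_conditioning.
End sampling_sigma_algebras.

Lemma frob2_tr (R : realType) a b (A : 'M[R]_(a, b)) : frob2 A^T = frob2 A.
Proof.
rewrite /frob2 exchange_big; apply: eq_bigr => i _; apply: eq_bigr => j _.
by rewrite mxE.
Qed.

Lemma frob2_ge0 (R : realType) a b (A : 'M[R]_(a, b)) : 0 <= frob2 A.
Proof. by do 2 apply: sumr_ge0 => ? _; rewrite sqr_ge0. Qed.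

Lemma measurable_frob2 (R : realType) d (Y : measurableType d) a b
    (A : Y -> 'M[R]_(a, b)) : mx_rv A -> measurable_fun setT (fun y => frob2 (A y)).
Proof.
move=> mA; do 2 apply: measurable_sum => ?.
exact: measurable_funX.
Qed.

Lemma mx_rv_comp (R : realType) d d' (Y : measurableType d) (Z : measurableType d')
    a b (A : Y -> 'M[R]_(a, b)) (f : Z -> Y) :
  mx_rv A -> measurable_fun setT f -> mx_rv (fun z => A (f z)).
Proof. by move=> mA mf i j; exact: measurableT_comp (mA i j) mf. Qed.

(** * Moments of the noise and of the projected gradient *)

Section golore_expectation.
Variables (R : realType) (NL : nat) (m n r : 'I_NL -> nat).
Local Notation params := (params R m n).
Variables (dX : measure_display) (Xi : measurableType dX) (D : probability Xi R).
Variables (F : params -> Xi -> R) (gF : params -> Xi -> params).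
Variables (gradf : params -> params) (L : R) (sigma : 'I_NL -> R).
Variables (dO : measure_display) (Om : measurableType dO) (P : probability Om R).
Variables (xi : nat -> Om -> Xi).
Variables (Pm : nat -> forall l : 'I_NL, Om -> 'M[R]_(m l, r l)).
Variables (Qm : nat -> forall l : 'I_NL, Om -> 'M[R]_(n l, r l)).
Variables (x0 : params) (beta eta : R) (tau : nat).
Hypothesis F_grad : forall z, is_gradient (fun x => F x z) (fun x => gF x z).
Hypothesis F_int : forall x, D.-integrable setT (fun z => (F x z)%:E).
Hypothesis L_gt0 : 0 < L.
Hypothesis g_lip : lipschitz_grad gradf L.
Hypothesis gF_int : forall x l i j, D.-integrable setT (fun z => (gF x z l i j)%:E).
Hypothesis gF_mean : forall x l i j,
  Rintegral D setT (fun z => gF x z l i j) = gradf x l i j.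
Hypothesis gF_var : forall x l, (\int[D]_z (frob2 (gF x z l - gradf x l))%:E
  <= (sigma l ^+ 2)%:E)%E.
Hypothesis mxi : forall t, measurable_fun setT (xi t).
Hypothesis xi_law : forall t B, measurable B -> P (xi t @^-1` B) = D B.
Hypothesis Pm_unif : forall k l, uniform_stiefel P (Pm k l).
Hypothesis Qm_unif : forall k l, uniform_stiefel P (Qm k l).
Hypothesis indep : mutual_indep P (golore_sigmas xi Pm Qm).
Hypothesis tau_gt0 : (0 < tau)%N.

(* [traj_M t] is the lifted momentum of step [t - 1]; [drift t] is the part of
   the momentum error at step [t] that does not involve the sample of step [t]. *)
Definition traj_x t w := golore_x x0 (fun s x => gF x (xi s w))
  (fun k l => Pm k l w) (fun k l => Qm k l w) beta eta tau t.
Definition traj_M t w := golore_lift x0 (fun s x => gF x (xi s w))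
  (fun k l => Pm k l w) (fun k l => Qm k l w) beta eta tau t.
Definition traj_proj k w : params -> params :=
  layer_proj (fun l => Pm k l w) (fun l => Qm k l w).
Definition noise t w := gF (traj_x t w) (xi t w) - gradf (traj_x t w).
Definition drift t w := drift_dir (fun k => traj_proj k w) gradf
  (fun t => traj_x t w) (fun t => traj_M t w) beta tau t.

Let mPm k l : mx_rv (Pm k l). Proof. by case: (Pm_unif k l). Qed.
Let mQm k l : mx_rv (Qm k l). Proof. by case: (Qm_unif k l). Qed.

Let F_meas x : measurable_fun setT (F x).
Proof. by apply/measurable_EFinP; exact: measurable_int (F_int x). Qed.

Let gF_rv d (Y : measurableType d) (X : Y -> params) (z : Y -> Xi) :
  params_rv X -> measurable_fun setT z -> params_rv (fun y => gF (X y) (z y)).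
Proof. exact: measurable_stoch_grad. Qed.

Let grad_rv d (Y : measurableType d) (X : Y -> params) :
  params_rv X -> params_rv (fun y => gradf (X y)).
Proof. by move=> mX; exact: (measurable_lipschitz_grad L_gt0 g_lip mX). Qed.

Let traj_x_rv t : params_rv (traj_x t).
Proof.
apply: golore_x_rv => [X z|s _|k l _|k l _].
- exact: gF_rv.
- exact: mxi.
- exact: mPm.
- exact: mQm.
Qed.

Let traj_M_rv t : params_rv (traj_M t).
Proof.
apply: golore_lift_rv => [X z|s _|k l _|k l _].
- exact: gF_rv.
- exact: mxi.
- exact: mPm.
- exact: mQm.
Qed.

Local Notation others := (others xi Pm Qm).

Let lt_neq_inl s t : (s < t)%N -> (inl s : nat + (nat * 'I_NL * bool)) != inl t.
Proof. by move=> st; apply/eqP => -[] stE; rewrite stE ltnn in st. Qed.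

Let noise_input_rv t : params_rv (fun wz : others (inl t) * Xi => traj_x t wz.1).
Proof.
move=> l; apply: (@mx_rv_comp _ _ _ _ _ _ _ (fun w : others (inl t) => traj_x t w l) fst).
  apply: golore_x_rv => [|s st|k l' _|k l' _]; first exact: gF_rv.
  - by apply: others_xi; exact: lt_neq_inl.
  - exact: others_Pm.
  - exact: others_Qm.
exact: measurable_fst.
Qed.

Let noise_pair_rv t : params_rv (fun wz : others (inl t) * Xi =>
  gF (traj_x t wz.1) wz.2 - gradf (traj_x t wz.1)).
Proof.
apply: params_rvB; last by apply: grad_rv; exact: noise_input_rv.
by apply: gF_rv; [exact: noise_input_rv|exact: measurable_snd].
Qed.

Let noise_rv t : params_rv (noise t).
Proof. by apply: params_rvB; [exact: gF_rv|exact: grad_rv]. Qed.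

Let noise_var_le x : (\int[D]_z (psqnorm (gF x z - gradf x))%:E
  <= (\sum_(l < NL) sigma l ^+ 2)%:E)%E.
Proof.
rewrite -sumEFin; under eq_integral do rewrite /psqnorm -sumEFin.
rewrite ge0_integral_sum//.
- by apply: lee_sum => l _; exact: gF_var.
- move=> l; apply/measurable_EFinP; apply: measurable_frob2.
  apply: mx_rv_sub => i j; last exact: (@measurable_cst _ _ _ _ _ (gradf x l i j)).
  by apply/measurable_EFinP; exact: measurable_int (gF_int x i j).
- by move=> l z _; rewrite lee_fin frob2_ge0.
Qed.

Let noise_second_moment t :
  (\int[P]_w (psqnorm (noise t w))%:E <= (\sum_(l < NL) sigma l ^+ 2)%:E)%E.
Proof.
pose h (w : Om) (z : Xi) := (psqnorm (gF (traj_x t w) z - gradf (traj_x t w)))%:E.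
have := @xi_tonelli _ _ _ _ _ _ _ _ _ P _ _ _ mxi mPm mQm indep D xi_law t h.
rewrite /h => -> /=; last 2 first.
- by apply/measurable_EFinP; apply: measurable_psqnorm; exact: noise_pair_rv.
- by move=> w z; rewrite lee_fin psqnorm_ge0.
apply: (@le_trans _ _ (\int[P]_w (\sum_(l < NL) sigma l ^+ 2)%:E)%E).
  apply: ge0_le_integral => //.
  - by move=> w _; apply: integral_ge0 => z _; rewrite lee_fin psqnorm_ge0.
  - have mh : measurable_fun [set: others (inl t) * Xi] (fun wz => h wz.1 wz.2).
      by apply/measurable_EFinP; apply: measurable_psqnorm; exact: noise_pair_rv.
    have := @measurable_fun_fubini_tonelli_F _ _ _ _ R D _ mh _.
    move=> /(_ (fun wz => _ : 0 <= _)%E) mF.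
    apply: (measurableT_comp (f := _ : others (inl t) -> _) (mF _)).
      by move=> wz; rewrite lee_fin psqnorm_ge0.
    exact: measurable_to_others.
by rewrite integral_cst// [X in (_ * X)%E](probability_setT P) mule1.
Qed.

Lemma noise_sqint t : sqint P (noise t).
Proof.
split => //; apply/integrableP; split.
  by apply/measurable_EFinP; exact: measurable_psqnorm.
apply: le_lt_trans (ltry _); apply: le_trans (noise_second_moment t).
by under eq_integral => w _ do rewrite /= ger0_norm ?psqnorm_ge0//.
Qed.

Lemma noise_var t : \int[P]_w psqnorm (noise t w) <= \sum_(l < NL) sigma l ^+ 2.
Proof.
rewrite -lee_fin [leLHS]fineK; first exact: noise_second_moment.
by apply: integrable_fin_num => //; case: (noise_sqint t).
Qed.

Let PTP k l w : (Pm k l w)^T *m Pm k l w = 1%:M. Proof. by case: (Pm_unif k l). Qed.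
Let QTQ k l w : (Qm k l w)^T *m Qm k l w = 1%:M. Proof. by case: (Qm_unif k l). Qed.

Lemma traj_proj_lin k w a u v :
  traj_proj k w (a *: u + v) = a *: traj_proj k w u + traj_proj k w v.
Proof. exact: layer_proj_lin. Qed.

Lemma traj_proj_sym k w u v :
  pinner (traj_proj k w u) v = pinner u (traj_proj k w v).
Proof. exact: layer_proj_sym. Qed.

Lemma traj_proj_idem k w u : traj_proj k w (traj_proj k w u) = traj_proj k w u.
Proof. exact: layer_proj_idem. Qed.

Let sqint_proj k (U : Om -> params) : sqint P U ->
  sqint P (fun w => traj_proj k w (U w)).
Proof.
move=> [mU iU]; apply: le_sqint iU _; first exact: params_rv_proj.
move=> w; rewrite !psqnormE.
exact: (sq_proj_le (@pinnerC _ _ _ _) (@pinnerDl _ _ _ _) (@pinnerZl _ _ _ _)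
  (@pinner_ge0 _ _ _ _) (@traj_proj_sym k w) (@traj_proj_idem k w)).
Qed.

Lemma traj_MS t w : traj_M t.+1 w = traj_proj (t %/ tau) w
  ((1 - beta) *: traj_M t w + beta *: (gradf (traj_x t w) + noise t w)).
Proof.
rewrite /traj_M golore_liftS /noise; congr (layer_proj _ _ (_ + beta *: _)).
by rewrite addrC subrK.
Qed.

Lemma traj_xS t w : traj_x t.+1 w = traj_x t w - eta *: traj_M t.+1 w.
Proof. exact: golore_xS. Qed.

Let grad_sqint U : sqint P U -> sqint P (fun w => gradf (U w)).
Proof. by move=> hU; exact: (sqint_lipschitz L_gt0 g_lip hU). Qed.

(** Projections do not increase norms, the gradient is Lipschitz and the noise has a finite second
    moment, so square integrability passes from step to step. It makes the expectations below finite
    and lets them be split. *)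
Lemma traj_sqint t : sqint P (traj_x t) /\ sqint P (traj_M t).
Proof.
elim: t => [|t [hx hM]].
  split; first exact: (sqint_cst _ x0).
  have -> : traj_M 0 = (fun=> 0) by apply/funext => w; exact: golore_lift0.
  exact: sqint_cst.
have hM' : sqint P (traj_M t.+1).
  have -> : traj_M t.+1 = (fun w => traj_proj (t %/ tau) w ((1 - beta) *: traj_M t w
      + beta *: (gradf (traj_x t w) + noise t w))).
    by apply/funext => w; exact: traj_MS.
  apply: sqint_proj; apply: sqintD; apply: sqintZ => //; apply: sqintD.
    exact: grad_sqint.
  exact: noise_sqint.
split => //.
have -> : traj_x t.+1 = (fun w => traj_x t w - eta *: traj_M t.+1 w).
  by apply/funext => w; exact: traj_xS.
by apply: sqintB => //; exact: sqintZ.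
Qed.

Lemma traj_grad_sqint t : sqint P (fun w => gradf (traj_x t w)).
Proof. by apply: grad_sqint; case: (traj_sqint t). Qed.

Lemma drift_sqint t : sqint P (drift t).
Proof.
apply: sqint_proj; apply: sqintZ; apply: sqintB.
  by case: (traj_sqint t).
exact: traj_grad_sqint.
Qed.

(** The drift involves [xi s] for [s < t] and the projection in force at step [t]. Even if that
    projection is drawn at step [t], it is a source different from [xi t]. *)
Let drift_pair_rv t : params_rv (fun wz : others (inl t) * Xi => drift t wz.1).
Proof.
move=> l; apply: (@mx_rv_comp _ _ _ _ _ _ _ (fun w : others (inl t) => drift t w l) fst);
  last exact: measurable_fst.
apply: params_rv_proj => [k|k|].
- exact: others_Pm.
- exact: others_Qm.
apply: params_rvZ; apply: params_rvB.
  apply: golore_lift_rv => [|s st|k l' _|k l' _]; first exact: gF_rv.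
  - by apply: others_xi; exact: lt_neq_inl.
  - exact: others_Pm.
  - exact: others_Qm.
apply: grad_rv; apply: golore_x_rv => [|s st|k l' _|k l' _]; first exact: gF_rv.
- by apply: others_xi; exact: lt_neq_inl.
- exact: others_Pm.
- exact: others_Qm.
Qed.

Let noise_centered (c x : params) : (\int[D]_z (pinner c (gF x z - gradf x))%:E = 0)%E.
Proof.
have i0 l i j : D.-integrable setT (EFin \o (fun z => gF x z l i j - gradf x l i j)).
  exact: (integrableB measurableT (gF_int x i j) (integrable_EFin_cst D (gradf x l i j))).
have i1 l i j : D.-integrable setT (EFin \o (fun z => c l i j * (gF x z - gradf x) l i j)).
  have := integrable_EFinZ (c l i j) (i0 _ i j).
  by apply: eq_integrable => // z _ /=; rewrite !mxE.
have ip : D.-integrable setT (EFin \o (fun z => pinner c (gF x z - gradf x))).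
  by do 3 apply: integrable_EFin_sum => ?.
rewrite -[LHS]fineK ?integrable_fin_num//; congr (_%:E).
rewrite -[LHS]/(\int[D]_z (pinner c (gF x z - gradf x))) /pinner.
rewrite Rintegral_sum => [|l]; last by do 2 apply: integrable_EFin_sum => ?.
rewrite big1// => l _; rewrite Rintegral_sum => [|i]; last by apply: integrable_EFin_sum => ?.
rewrite big1// => i _; rewrite Rintegral_sum//.
rewrite big1// => j _.
transitivity (\int[D]_z (c l i j * (gF x z l i j - gradf x l i j))).
  by apply: eq_Rintegral => z _; rewrite !mxE.
rewrite RintegralZl//.
rewrite RintegralB//; [|exact: gF_int|exact: integrable_EFin_cst].
by rewrite gF_mean Rintegral_cst// [X in _ * fine X](probability_setT D) mulr1 subrr mulr0.
Qed.

Lemma drift_noise_orthogonal t : \int[P]_w pinner (drift t w) (noise t w) = 0.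
Proof.
pose h (w : Om) (z : Xi) := (pinner (drift t w) (gF (traj_x t w) z - gradf (traj_x t w)))%:E.
have := @xi_fubini _ _ _ _ _ _ _ _ _ P _ _ _ mxi mPm mQm indep D xi_law t h.
rewrite /Rintegral /h => -> /=.
- under eq_integral do rewrite noise_centered.
  by rewrite integral0.
- apply/measurable_EFinP; apply: measurable_pinner; first exact: drift_pair_rv.
  exact: noise_pair_rv.
- by apply: integrable_pinner; [exact: drift_sqint|exact: noise_sqint].
Qed.

(** The iterate at time [k * tau] is computed before the projections of index [k] come into use: it
    involves only indices [k'] with [k' * tau < k * tau], so [k'] differs from [k]. *)
Let epoch_grad_rv k l b :
  params_rv (fun w : others (inr (k, l, b)) => gradf (traj_x (k * tau) w)).
Proof.
have kk k' (b' : bool) (l' : 'I_NL) : (k' * tau < k * tau)%N ->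
    (inr (k', l', b') : nat + (nat * 'I_NL * bool)) != inr (k, l, b).
  by rewrite ltn_mul2r tau_gt0 /= => lt; apply/eqP => -[] kE; rewrite kE ltnn in lt.
apply: grad_rv; apply: golore_x_rv => [|s _|k' l' lt|k' l' lt]; first exact: gF_rv.
- exact: others_xi.
- by apply: others_Pm; exact: kk.
- by apply: others_Qm; exact: kk.
Qed.

Let proj_layer_tonelli a b c k l s (M : Om -> 'M[R]_(a, b))
    (U : Om -> 'M[R]_(a, c)) : uniform_stiefel P M ->
  golore_sigmas xi Pm Qm (inr (k, l, s)) = mx_sigma M ->
  mx_rv (U : others (inr (k, l, s)) -> _) ->
  (\int[P]_w (frob2 (M w *m (M w)^T *m U w))%:E =
   (b%:R / a%:R)%:E * \int[P]_w (frob2 (U w))%:E)%E.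
Proof.
move=> M_unif iM mU; have [_ mM _] := M_unif.
pose h (w w' : Om) := (frob2 (M w' *m (M w')^T *m U w))%:E.
have := @mx_tonelli _ _ _ _ _ _ _ _ _ P _ _ _ mxi mPm mQm indep _ _ M _ mM iM h.
rewrite /h => -> /=; last 2 first.
- have mM2 : mx_rv (fun ww : others (inr (k, l, s)) * mx_gen M => M ww.2).
    exact: (mx_rv_comp (@mx_gen_rv _ _ _ _ _ M) measurable_snd).
  apply/measurable_EFinP; apply: measurable_frob2; apply: mx_rv_mul.
    by apply: mx_rv_mul => //; exact: mx_rv_tr.
  exact: (mx_rv_comp mU measurable_fst).
- by move=> w w'; rewrite lee_fin frob2_ge0.
under eq_integral do rewrite uniform_stiefel_frob2// EFinM.
rewrite ge0_integralZl//.
- apply/measurable_EFinP; apply: measurable_frob2 => i j _ B mB.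
  by rewrite setTI; apply: (measurable_others mxi mPm mQm (i := inr (k, l, s)));
    rewrite -[X in measurable X]setTI; exact: mU.
- by move=> w _; rewrite lee_fin frob2_ge0.
Qed.

Lemma proj_layer_moment k l :
  (\int[P]_w (frob2 (traj_proj k w (gradf (traj_x (k * tau) w)) l))%:E =
   ((r l)%:R / (minn (m l) (n l))%:R)%:E *
   \int[P]_w (frob2 (gradf (traj_x (k * tau) w) l))%:E)%E.
Proof.
have eP : golore_sigmas xi Pm Qm (inr (k, l, true)) = mx_sigma (Pm k l) by [].
have eQ : golore_sigmas xi Pm Qm (inr (k, l, false)) = mx_sigma (Qm k l) by [].
rewrite /traj_proj /layer_proj; case: (leqP (m l) (n l)) => mn.
  by rewrite (proj_layer_tonelli (Pm_unif k l) eP)//; exact: epoch_grad_rv.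
(* Transposition turns the projection on the right into one on the left of the transposed gradient,
   and the same moment formula applies, now with [n l] in the denominator. *)
transitivity (\int[P]_w (frob2 (Qm k l w *m (Qm k l w)^T *m
    (gradf (traj_x (k * tau) w) l)^T))%:E)%E.
  by apply: eq_integral => w _; rewrite -frob2_tr !trmx_mul trmxK.
rewrite (proj_layer_tonelli (Qm_unif k l) eQ); last first.
  by apply: mx_rv_tr; exact: epoch_grad_rv.
by congr (_ * _)%E; apply: eq_integral => w _; rewrite frob2_tr.
Qed.

Let frob2_integrable (U : Om -> params) l : sqint P U ->
  P.-integrable setT (EFin \o (fun w => frob2 (U w l))).
Proof.
move=> [mU iU]; apply: le_integrable iU => //.
  by apply/measurable_EFinP; apply: measurable_frob2; exact: mU.
move=> w _ /=; rewrite lee_fin !ger0_norm ?psqnorm_ge0 ?frob2_ge0//.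
by rewrite /psqnorm (bigD1 l)//= lerDl sumr_ge0// => ? _; exact: frob2_ge0.
Qed.

Lemma traj_proj_sqint k t : sqint P (fun w => traj_proj k w (gradf (traj_x t w))).
Proof. by apply: sqint_proj; exact: traj_grad_sqint. Qed.

Lemma proj_grad_moment_ge dl k :
  (forall l, dl <= (r l)%:R / (minn (m l) (n l))%:R) ->
  dl * \int[P]_w psqnorm (gradf (traj_x (k * tau) w)) <=
  \int[P]_w psqnorm (traj_proj k w (gradf (traj_x (k * tau) w))).
Proof.
move=> dlr; have ig l := frob2_integrable l (traj_grad_sqint (k * tau)).
have ip l := frob2_integrable l (traj_proj_sqint k (k * tau)).
rewrite /psqnorm !Rintegral_sum// mulr_sumr; apply: ler_sum => l _.
have -> : \int[P]_w frob2 (traj_proj k w (gradf (traj_x (k * tau) w)) l) =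
    (r l)%:R / (minn (m l) (n l))%:R * \int[P]_w frob2 (gradf (traj_x (k * tau) w) l).
  rewrite /Rintegral proj_layer_moment fineM//.
  exact: (integrable_fin_num measurableT (ig l)).
by rewrite ler_wpM2r// Rintegral_ge0// => w _; exact: frob2_ge0.
Qed.

Lemma traj_expected_bound (f : params -> R) (finf dl : R) T :
  is_gradient f gradf -> (forall x, finf <= f x) ->
  0 < beta <= 1 -> 0 < eta -> 0 <= dl <= 1 ->
  (forall l, dl <= (r l)%:R / (minn (m l) (n l))%:R) ->
  2 / tau%:R <= 3 / 32 * (dl * beta) ->
  L * eta + L ^+ 2 * eta ^+ 2 / beta ^+ 2 + 2 * L ^+ 2 * eta ^+ 2 * tau%:R / beta
    + 3 / 2 * L ^+ 2 * eta ^+ 2 * tau%:R ^+ 2 <= 1 ->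
  5 / 32 * dl * \sum_(t < T) \int[P]_w psqnorm (gradf (traj_x t w))
  <= 2 * (f x0 - finf) / eta + 2 * L * (f x0 - finf) / beta
     + T%:R * (beta * \sum_(l < NL) sigma l ^+ 2).
Proof.
move=> fg f_ge beta01 eta0 dl01 dlr tauE etaE.
have beta0 : 0 <= beta by case/andP: beta01 => /ltW.
pose K := 2 * (f x0 - finf) / eta + 2 * L * (f x0 - finf) / beta.
pose k t := (t %/ tau)%N.
have path w : 5 / 32 * dl * \sum_(t < T) psqnorm (gradf (traj_x t w))
    + 2^-1 * \sum_(t < T) (psqnorm (traj_proj (k t) w (gradf (traj_x (k t * tau) w)))
                            + (- dl) * psqnorm (gradf (traj_x (k t * tau) w)))
  <= K + \sum_(t < T) (2 * pinner (drift t w) (noise t w) + beta * psqnorm (noise t w)).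
  have := @trajectory_bound R params (@pinner R NL m n) (@pinnerC _ _ _ _) (@pinnerDl _ _ _ _)
    (@pinnerZl _ _ _ _) (@pinner_ge0 _ _ _ _) (fun k => traj_proj k w) f gradf L finf
    (fun t => traj_x t w) (fun t => traj_M t w) (fun t => noise t w) beta eta dl tau
    (fun k => @traj_proj_lin k w) (fun k => @traj_proj_sym k w)
    (fun k => @traj_proj_idem k w) L_gt0
    (fun x v => smooth_descent x v L_gt0 fg g_lip)
    (fun x y => lipschitz_grad_sq x y L_gt0 g_lip) f_ge beta01 eta0 tau_gt0
    (golore_lift0 _ _ _ _ _ _ _) (fun t => traj_MS t w) (fun t => traj_xS t w)
    T dl01 tauE etaE.
  have psqE : @psqnorm R NL m n = (fun x => pinner x x).
    by apply/funext => x; exact: psqnormE.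
  rewrite psqE => h; under [X in _ + _ * X <= _]eq_bigr do rewrite mulNr.
  exact: h.
have ig t : P.-integrable setT (EFin \o (fun w => psqnorm (gradf (traj_x t w)))).
  by case: (traj_grad_sqint t).
have ip k' t : P.-integrable setT
    (EFin \o (fun w => psqnorm (traj_proj k' w (gradf (traj_x t w))))).
  by case: (traj_proj_sqint k' t).
have iN t : P.-integrable setT (EFin \o (fun w => psqnorm (noise t w))).
  by case: (noise_sqint t).
have iW t : P.-integrable setT (EFin \o (fun w => pinner (drift t w) (noise t w))).
  by apply: integrable_pinner; [exact: drift_sqint|exact: noise_sqint].
have iB (t : 'I_T) := integrable_EFinD (ip (k t) (k t * tau)%N)
  (integrable_EFinZ (- dl) (ig (k t * tau)%N)).
have iE (t : 'I_T) := integrable_EFinD (integrable_EFinZ 2 (iW t))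
  (integrable_EFinZ beta (iN t)).
have isG := integrable_EFin_sum (index_enum _) (fun t : 'I_T => ig t).
have isB := integrable_EFin_sum (index_enum _) iB.
have isE := integrable_EFin_sum (index_enum _) iE.
have iL := integrable_EFinD (integrable_EFinZ (5 / 32 * dl) isG) (integrable_EFinZ 2^-1 isB).
have iR := integrable_EFinD (integrable_EFin_cst P K) isE.
have := le_Rintegral measurableT iL iR (fun w _ => path w).
rewrite RintegralD//; [|exact: integrable_EFinZ|exact: integrable_EFinZ].
rewrite !RintegralZl// RintegralD//; last exact: integrable_EFin_cst.
rewrite !Rintegral_sum// Rintegral_cst// [X in _ * fine X](probability_setT P) mulr1.
have hB : 0 <= \sum_(t < T) \int[P]_w (psqnorm (traj_proj (k t) w (gradf (traj_x (k t * tau) w)))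
    + (- dl) * psqnorm (gradf (traj_x (k t * tau) w))).
  apply: sumr_ge0 => t _; rewrite RintegralD//; last exact: integrable_EFinZ.
  rewrite RintegralZl// mulNr subr_ge0; exact: proj_grad_moment_ge.
have hE : \sum_(t < T) \int[P]_w (2 * pinner (drift t w) (noise t w) + beta * psqnorm (noise t w))
    <= T%:R * (beta * \sum_(l < NL) sigma l ^+ 2).
  rewrite mulr_natl -[X in _ <= _ *+ X]card_ord -sumr_const; apply: ler_sum => t _.
  rewrite RintegralD//; [|exact: integrable_EFinZ|exact: integrable_EFinZ].
  rewrite !RintegralZl// drift_noise_orthogonal mulr0 add0r.
  by rewrite ler_wpM2l//; exact: noise_var.
rewrite /K; lra.
Qed.

End golore_expectation.

(** * Step sizes *)

Section step_sizes.
Variables (R : realType) (dl sig2 L Del : R) (T : nat).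
Hypothesis dl_gt0 : 0 < dl.
Hypothesis dl_le1 : dl <= 1.
Hypothesis sig2_ge0 : 0 <= sig2.
Hypothesis L_gt0 : 0 < L.
Hypothesis Del_gt0 : 0 < Del.
Hypothesis T_gt0 : (0 < T)%N.

Let beta := golore_beta dl sig2 L Del T.
Let tau := golore_tau dl beta.
Let eta := golore_eta dl L beta tau.
(** Half-integer powers of [dl] become integer powers of [d], within reach of [field]; [s] likewise
    turns [1 / beta] into [1 + s]. *)
Let d := Num.sqrt dl.
Let s := Num.sqrt (dl * Num.sqrt dl * sig2 * T%:R / (L * Del)).

Let d_gt0 : 0 < d. Proof. by rewrite sqrtr_gt0. Qed.
Let d_le1 : d <= 1. Proof. by rewrite -sqrtr1 ler_sqrt. Qed.
Let dlE : dl = d ^+ 2. Proof. by rewrite sqr_sqrtr// ltW. Qed.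
Let s_ge0 : 0 <= s. Proof. exact: sqrtr_ge0. Qed.
Let s1_gt0 : 0 < 1 + s. Proof. by rewrite ltr_pwDl. Qed.
Let betaV : beta^-1 = 1 + s. Proof. by rewrite invrK. Qed.
Let T0 : 0 < T%:R :> R. Proof. by rewrite ltr0n. Qed.

Lemma golore_beta01 : 0 < beta <= 1.
Proof.
rewrite /beta /golore_beta invr_gt0 -/s s1_gt0 /= invf_le1// lerDl.
exact: s_ge0.
Qed.

Let beta_gt0 : 0 < beta. Proof. by case/andP: golore_beta01. Qed.
Let beta_le1 : beta <= 1. Proof. by case/andP: golore_beta01. Qed.

(** Rounding up adds at most 1, which is at most [1 / (dl * beta)], and [64/3 + 1 < 23]. *)
Lemma golore_tau_bounds :
  64 / (3 * dl * beta) <= tau%:R <= 23 / (dl * beta).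
Proof.
have db0 : 0 < dl * beta by rewrite mulr_gt0.
set y := 64 / (3 * dl * beta).
have y0 : 0 < y by rewrite divr_gt0// -mulrA mulr_gt0.
have tauE : tau%:R = (Num.ceil y)%:~R :> R.
  by rewrite /tau /golore_tau -/y natr_absz gtr0_norm// ceil_gt0.
rewrite tauE; apply/andP; split; first exact: ceil_ge.
have h : (Num.ceil y)%:~R < y + 1.
  by have := ceilB1_lt y; rewrite intrB; lra.
apply: le_trans (ltW h) _.
have -> : y = 64 / 3 / (dl * beta) by rewrite /y; field; rewrite !gt_eqF.
rewrite ler_pdivlMr// mulrDl divfK ?gt_eqF// mul1r.
have : dl * beta <= 1 by rewrite mulr_ile1// ltW.
lra.
Qed.

Let tau_ge0 : 0 <= tau%:R :> R. Proof. exact: ler0n. Qed.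

Lemma golore_tau_gt0 : (0 < tau)%N.
Proof.
rewrite -(@ltr0n R); case/andP: golore_tau_bounds => h _; apply: lt_le_trans h.
by rewrite divr_gt0// !mulr_gt0.
Qed.

(** The lower bound [64 / (3 * dl * beta)] on [tau] is exactly the value at which the two sides
    agree. *)
Lemma golore_tau_inv_le : 2 / tau%:R <= 3 / 32 * (dl * beta).
Proof.
have t0 : 0 < tau%:R :> R by rewrite ltr0n golore_tau_gt0.
case/andP: golore_tau_bounds => h _; move: h.
rewrite ler_pdivrMr ?mulr_gt0// ler_pdivrMr//; lra.
Qed.

Let S1 := Num.sqrt (80 * L ^+ 2 / (3 * dl * beta ^+ 2)).
Let S2 := Num.sqrt (80 * tau%:R ^+ 2 * L ^+ 2 / (3 * dl)).
Let S3 := Num.sqrt (16 * tau%:R * L ^+ 2 / (3 * beta)).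
Let etaE : eta = (4 * L + S1 + S2 + S3)^-1. Proof. by []. Qed.
Let den_gt0 : 0 < 4 * L + S1 + S2 + S3.
Proof.
by rewrite -!addrA ltr_pwDl ?mulr_gt0// !addr_ge0// sqrtr_ge0.
Qed.

Lemma golore_eta_gt0 : 0 < eta. Proof. by rewrite etaE invr_gt0. Qed.

(** Multiplied by [eta], the four summands of [1 / eta] become nonnegative shares of 1. Each term on
    the left is either linear in one share or a small multiple of its square, hence at most that
    share. *)
Lemma golore_eta_coef :
  L * eta + L ^+ 2 * eta ^+ 2 / beta ^+ 2 + 2 * L ^+ 2 * eta ^+ 2 * tau%:R / beta
    + 3 / 2 * L ^+ 2 * eta ^+ 2 * tau%:R ^+ 2 <= 1.
Proof.
have eta0 := golore_eta_gt0.
have sum1 : 4 * (L * eta) + S1 * eta + S2 * eta + S3 * eta = 1.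
  by rewrite mulrA -!mulrDl etaE divff// gt_eqF.
have p0 : 0 <= L * eta by rewrite ltW// mulr_gt0.
have q0 : 0 <= S1 * eta by rewrite mulr_ge0 ?sqrtr_ge0// ltW.
have r0 : 0 <= S2 * eta by rewrite mulr_ge0 ?sqrtr_ge0// ltW.
have u0 : 0 <= S3 * eta by rewrite mulr_ge0 ?sqrtr_ge0// ltW.
have e1 : L ^+ 2 * eta ^+ 2 / beta ^+ 2 = 3 / 80 * dl * (S1 * eta) ^+ 2.
  rewrite exprMn sqr_sqrtr; first by field; rewrite !gt_eqF.
  by rewrite divr_ge0 ?mulr_ge0 ?exprn_ge0// ltW.
have e2 : L ^+ 2 * eta ^+ 2 * tau%:R ^+ 2 = 3 / 80 * dl * (S2 * eta) ^+ 2.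
  rewrite exprMn sqr_sqrtr; first by field; rewrite !gt_eqF.
  by rewrite divr_ge0 ?mulr_ge0 ?exprn_ge0// ltW.
have e3 : L ^+ 2 * eta ^+ 2 * tau%:R / beta = 3 / 16 * (S3 * eta) ^+ 2.
  rewrite exprMn sqr_sqrtr; first by field; rewrite !gt_eqF.
  by rewrite divr_ge0 ?mulr_ge0 ?exprn_ge0// ltW.
rewrite -(mulrA (3 / 2)) -(mulrA (3 / 2)) e2 e1.
rewrite -2!(mulrA 2) -(mulrA 2) e3.
have sq (z : R) : 0 <= z -> z <= 1 -> z ^+ 2 <= z.
  by move=> z0 z1; rewrite expr2 ler_piMl.
have dsq (z : R) : 0 <= z -> z <= 1 -> dl * z ^+ 2 <= z.
  move=> z0 z1; apply: le_trans (sq z z0 z1); rewrite ler_piMl// exprn_ge0//.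
have := dsq _ q0 _; have := dsq _ r0 _; have := sq _ u0 _.
move=> /(_ ltac:(lra)) h3 /(_ ltac:(lra)) h2 /(_ ltac:(lra)) h1.
lra.
Qed.

Let sqrt_le (y z : R) : 0 <= z -> y <= z ^+ 2 -> Num.sqrt y <= z.
Proof.
by move=> z0 yz; rewrite -(ger0_norm z0) -sqrtr_sqr ler_sqrt// sqr_ge0.
Qed.

(** Each summand is compared with [L / (d^3 beta)], the size of the one containing [tau^2], which
    carries the worst power of [d]. The constants are [4 + 6 + 138 + 12]: here 6 exceeds the root of
    80/3, [138 = 6 * 23], and 12 exceeds the root of 368/3. *)
Lemma golore_eta_inv_le : eta^-1 <= 160 * (L / (d ^+ 3 * beta)).
Proof.
have db0 : 0 < d * beta by rewrite mulr_gt0.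
have d3b0 : 0 < d ^+ 3 * beta by rewrite mulr_gt0// exprn_gt0.
set w := L / (d ^+ 3 * beta).
have w0 : 0 < w by rewrite divr_gt0.
have LE : L = d ^+ 3 * beta * w by rewrite /w mulrC divfK// gt_eqF.
have dbw (c : R) : 0 <= c <= 1 -> c * w <= w.
  by move=> /andP[_ c1]; rewrite ler_piMl// ltW.
have d1 : 0 <= d ^+ 2 <= 1 by rewrite exprn_ge0 ?exprn_ile1// ltW.
have d0 := ltW d_gt0; have b0 := ltW beta_gt0; have w0' := ltW w0.
have LDb : L / (d * beta) = d ^+ 2 * w by rewrite LE; field; rewrite !gt_eqF.
have taule : tau%:R <= 23 / (d ^+ 2 * beta).
  by case/andP: golore_tau_bounds => _; rewrite dlE.
have h0 : L <= w.
  rewrite {1}LE dbw// mulr_ge0 ?exprn_ge0//= mulr_ile1// ?exprn_ge0//.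
  by rewrite exprn_ile1.
have h1 : S1 <= 6 * w.
  apply: le_trans (_ : 6 * (d ^+ 2 * w) <= _); last first.
    by rewrite ler_pM2l// dbw.
  rewrite -LDb; apply: sqrt_le; first by rewrite mulr_ge0// divr_ge0 ?mulr_ge0// ltW.
  have -> : 80 * L ^+ 2 / (3 * dl * beta ^+ 2) = 80 / 3 * (L / (d * beta)) ^+ 2.
    by rewrite dlE; field; rewrite !gt_eqF.
  rewrite [leRHS]exprMn; apply: ler_wpM2r; first exact: sqr_ge0.
  lra.
have h2 : S2 <= 138 * w.
  apply: le_trans (_ : 6 * (tau%:R * (L / d)) <= _); last first.
    apply: le_trans (_ : 6 * (23 / (d ^+ 2 * beta) * (L / d)) <= _).
      by rewrite ler_pM2l// ler_wpM2r// divr_ge0// ltW.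
    rewrite [X in X <= _](_ : _ = 138 * w)// /w; field; rewrite !gt_eqF//.
  apply: sqrt_le; first by rewrite !mulr_ge0// ?invr_ge0 ltW.
  have -> : 80 * tau%:R ^+ 2 * L ^+ 2 / (3 * dl) = 80 / 3 * (tau%:R * (L / d)) ^+ 2.
    by rewrite dlE; field; rewrite !gt_eqF.
  rewrite [leRHS]exprMn; apply: ler_wpM2r; first exact: sqr_ge0.
  lra.
have h3 : S3 <= 12 * w.
  apply: le_trans (_ : 12 * (d ^+ 2 * w) <= _); last first.
    by rewrite ler_pM2l// dbw.
  rewrite -LDb; apply: sqrt_le; first by rewrite mulr_ge0// divr_ge0 ?mulr_ge0// ltW.
  apply: le_trans (_ : 16 * (23 / (d ^+ 2 * beta)) * L ^+ 2 / (3 * beta) <= _).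
    rewrite ler_wpM2r ?invr_ge0 ?mulr_ge0// ler_wpM2r ?exprn_ge0 ?(ltW L_gt0)//.
    by rewrite ler_pM2l.
  have -> : 16 * (23 / (d ^+ 2 * beta)) * L ^+ 2 / (3 * beta) =
      368 / 3 * (L / (d * beta)) ^+ 2 by field; rewrite !gt_eqF.
  rewrite [leRHS]exprMn; apply: ler_wpM2r; first exact: sqr_ge0.
  lra.
rewrite etaE invrK; move: h0 h1 h2 h3; lra.
Qed.

(** With [A] the first term of the rate, the second is exactly [A * s]. The descent terms are at
    most 322 times [T d^2 A (1 + s)], because [1 / beta = 1 + s], and the noise is at most
    [T d^2 A s], because [beta * s <= 1]. Dividing by 5/32 gives [323 * 32 / 5 < 2068]. *)
Lemma golore_rate (G : R) :
  5 / 32 * dl * G <= 2 * Del / eta + 2 * L * Del / beta + T%:R * (beta * sig2) ->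
  T%:R^-1 * G <= 2068 *
    (L * Del / (dl ^+ 2 * Num.sqrt dl * T%:R)
     + Num.sqrt (L * Del * sig2 / (dl ^+ 3 * Num.sqrt dl * T%:R))).
Proof.
move=> hG; set A := L * Del / (dl ^+ 2 * Num.sqrt dl * T%:R).
have dn0 : d != 0 by rewrite gt_eqF.
have Tn0 : T%:R != 0 :> R by rewrite gt_eqF.
have Ln0 : L != 0 by rewrite gt_eqF.
have Deln0 : Del != 0 by rewrite gt_eqF.
have A0 : 0 < A by rewrite divr_gt0 ?mulr_gt0 ?exprn_gt0.
have s2 : s ^+ 2 = d ^+ 3 * sig2 * T%:R / (L * Del).
  rewrite sqr_sqrtr; last by rewrite divr_ge0 ?mulr_ge0 ?sqrtr_ge0// ltW.
  by rewrite -/d {1}dlE -exprSr.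
have BE : Num.sqrt (L * Del * sig2 / (dl ^+ 3 * Num.sqrt dl * T%:R)) = A * s.
  have -> : A * s = Num.sqrt ((A * s) ^+ 2).
    by rewrite sqrtr_sqr ger0_norm// mulr_ge0// ltW.
  congr Num.sqrt.
  by rewrite exprMn s2 /A -/d dlE; field; rewrite dn0 Tn0 Ln0 Deln0.
rewrite BE.
have bs : beta * sig2 / d ^+ 2 <= A * s.
  have -> : beta * sig2 / d ^+ 2 = A * (s ^+ 2 * beta).
    by rewrite s2 /A -/d dlE; field; rewrite dn0 Tn0 Ln0 Deln0.
  rewrite ler_pM2l// expr2 -mulrA ler_piMr//.
  by rewrite -[beta]invrK betaV ler_pdivrMr// mul1r lerDr.
have h1 : 2 * Del / eta <= 320 * (L * Del / (d ^+ 3 * beta)).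
  have -> : 320 * (L * Del / (d ^+ 3 * beta)) = 2 * Del * (160 * (L / (d ^+ 3 * beta))).
    by field; rewrite dn0 gt_eqF.
  by rewrite ler_pM2l ?mulr_gt0// golore_eta_inv_le.
have h2 : 2 * L * Del / beta <= 2 * (L * Del / (d ^+ 3 * beta)).
  have -> : 2 * L * Del / beta = 2 * (L * Del / beta) by rewrite !mulrA.
  rewrite ler_pM2l// ler_pM2l ?mulr_gt0// lef_pV2 ?posrE ?mulr_gt0 ?exprn_gt0//.
  by apply: ler_piMl; [exact: ltW|rewrite exprn_ile1// ltW].
have eA : L * Del / (d ^+ 3 * beta) = T%:R * d ^+ 2 * (A * (1 + s)).
  by rewrite -betaV /A -/d dlE; field; rewrite dn0 Tn0 gt_eqF.
have h3 : T%:R * (beta * sig2) <= T%:R * d ^+ 2 * (A * s).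
  by rewrite -mulrA ler_pM2l// [leRHS]mulrC -ler_pdivrMr ?exprn_gt0.
have Td0 : 0 < T%:R * d ^+ 2 by rewrite mulr_gt0 ?exprn_gt0.
have As0 : 0 <= A * s by rewrite mulr_ge0// ltW.
have h4 : 5 / 32 * (T%:R * d ^+ 2 * (T%:R^-1 * G)) <=
    T%:R * d ^+ 2 * (322 * (A * (1 + s)) + A * s).
  have -> : 5 / 32 * (T%:R * d ^+ 2 * (T%:R^-1 * G)) = 5 / 32 * dl * G.
    by rewrite dlE; field.
  by move: hG h1 h2 h3; rewrite eA; lra.
move: h4; rewrite mulrCA ler_pM2l// => h4.
by move: h4 As0 (ltW A0); rewrite mulrDr mulr1; lra.
Qed.

End step_sizes.

(** * The smallest rank ratio and the convergence rate *)

Lemma delta_min_gt0 (R : realType) (NL : nat) (m n r : 'I_NL -> nat) :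
  (forall l, (0 < r l < minn (m l) (n l))%N) -> 0 < delta_min R m n r.
Proof.
move=> hr; apply: (big_ind (fun x : R => 0 < x)) => // [x y x0 y0|l _].
  by rewrite lt_min x0.
by have /andP[r0 rm] := hr l; rewrite divr_gt0// ltr0n// (ltn_trans r0).
Qed.

Lemma delta_min_le (R : realType) (NL : nat) (m n r : 'I_NL -> nat) l :
  delta_min R m n r <= (r l)%:R / (minn (m l) (n l))%:R.
Proof. exact: bigmin_le. Qed.

Lemma delta_min_le1 (R : realType) (NL : nat) (m n r : 'I_NL -> nat) :
  delta_min R m n r <= 1.
Proof. exact: bigmin_le_id. Qed.

Theorem theorem4 : exists C : nat,
  forall (R : realType) (NL : nat) (m n r : 'I_NL -> nat)
    (dX : measure_display) (Xi : measurableType dX) (D : probability Xi R)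
    (F : params R m n -> Xi -> R) (gF : params R m n -> Xi -> params R m n)
    (f : params R m n -> R) (gradf : params R m n -> params R m n)
    (L : R) (sigma : 'I_NL -> R)
    (dO : measure_display) (Om : measurableType dO) (P : probability Om R)
    (xi : nat -> Om -> Xi)
    (Pm : nat -> forall l : 'I_NL, Om -> 'M[R]_(m l, r l))
    (Qm : nat -> forall l : 'I_NL, Om -> 'M[R]_(n l, r l))
    (x0 : params R m n) (T : nat),
  (* ranks *)
  (forall l, (0 < r l < minn (m l) (n l))%N) ->
  (* F(.; xi) is differentiable with gradient gF(.; xi); f = E_xi F *)
  (forall z, is_gradient (fun x => F x z) (fun x => gF x z)) ->
  (forall x, D.-integrable setT (fun z => (F x z)%:E)) ->
  (forall x, f x = Rintegral D setT (fun z => F x z)) ->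
  is_gradient f gradf ->
  (* Assumption 1 *)
  has_lbound (range f) ->
  (* Assumption 2 *)
  0 < L -> lipschitz_grad gradf L ->
  (* Assumption 3 *)
  (forall x l i j, D.-integrable setT (fun z => (gF x z l i j)%:E)) ->
  (forall x l i j, Rintegral D setT (fun z => gF x z l i j) = gradf x l i j) ->
  (forall x l, (\int[D]_z (frob2 (gF x z l - gradf x l))%:E
                  <= (sigma l ^+ 2)%:E)%E) ->
  (* the stochastic gradient is a random variable when evaluated at
     random points (joint measurability) *)
  (forall (X : Om -> params R m n) (z : Om -> Xi),
     (forall l i j, measurable_fun setT (fun w => X w l i j)) ->
     measurable_fun setT z ->
     forall l i j, measurable_fun setT (fun w => gF (X w) (z w) l i j)) ->
  (* Delta > 0 *)
  0 < f x0 - inf (range f) ->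
  (* sampling: xi^(t) ~ D, P ~ U(St), Q ~ U(St), all mutually independent *)
  (forall t, measurable_fun setT (xi t)) ->
  (forall t B, measurable B -> P (xi t @^-1` B) = D B) ->
  (forall k l, uniform_stiefel P (Pm k l)) ->
  (forall k l, uniform_stiefel P (Qm k l)) ->
  mutual_indep P (golore_sigmas xi Pm Qm) ->
  let dl := delta_min R m n r in
  let sig2 := \sum_(l < NL) sigma l ^+ 2 in
  let Del := f x0 - inf (range f) in
  2 + 128 / (3 * dl) + 128 ^+ 2 * sig2 / (9 * Num.sqrt dl * L * Del) <= T%:R ->
  let beta := golore_beta dl sig2 L Del T in
  let tau := golore_tau dl beta in
  let eta := golore_eta dl L beta tau in
  ((T%:R)^-1%:E *
     \sum_(t < T) \int[P]_w
        (psqnorm (gradf (golore_x x0 (fun s x => gF x (xi s w))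
                                  (fun k l => Pm k l w) (fun k l => Qm k l w)
                                  beta eta tau t)))%:E
   <= (C%:R * (L * Del / (dl ^+ 2 * Num.sqrt dl * T%:R)
               + Num.sqrt (L * Del * sig2 / (dl ^+ 3 * Num.sqrt dl * T%:R))))%:E)%E.
Proof.
exists 2068%N => R NL m n r dX Xi D F gF f gradf L sigma dO Om P xi Pm Qm x0 T.
move=> hr F_grad F_int _ f_grad f_lb L0 g_lip gF_int gF_mean gF_var _ Del0.
move=> mxi xi_law Pm_unif Qm_unif indep dl sig2 Del hT; cbv zeta.
set beta := golore_beta dl sig2 L Del T; set tau := golore_tau dl beta.
set eta := golore_eta dl L beta tau.
have dl0 : 0 < dl by exact: delta_min_gt0.
have dl1 : dl <= 1 by exact: delta_min_le1.
have sig0 : 0 <= sig2 by apply: sumr_ge0 => l _; exact: sqr_ge0.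
have T0 : (0 < T)%N.
  rewrite -(@ltr0n R); apply: lt_le_trans hT.
  rewrite -addrA ltr_pwDl// addr_ge0// divr_ge0// ?mulr_ge0 ?sqrtr_ge0 ?exprn_ge0//; exact: ltW.
have tau0 : (0 < tau)%N by exact: golore_tau_gt0.
have f_ge x : inf (range f) <= f x.
  by apply: ge_inf => //; exists x.
have bound := @traj_expected_bound R NL m n r dX Xi D F gF gradf L sigma dO Om P xi Pm Qm
  x0 beta eta tau F_grad F_int L0 g_lip gF_int gF_mean gF_var mxi xi_law Pm_unif Qm_unif
  indep tau0 f (inf (range f)) dl T f_grad f_ge.
have dl01 : 0 <= dl <= 1 by rewrite ltW.
have rate := golore_rate dl0 dl1 sig0 L0 Del0 T0 (bound
  (golore_beta01 dl sig2 L Del T) (golore_eta_gt0 dl sig2 Del T L0) dl01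
  (delta_min_le R m n r) (golore_tau_inv_le sig2 L Del T dl0 dl1)
  (golore_eta_coef sig2 Del T dl0 dl1 L0)).
(* The goal is about extended-real expectations; since each is finite, it reduces to the inequality
   between real numbers in [rate]. *)
have Gi t : P.-integrable setT
    (EFin \o (fun w => psqnorm (gradf (traj_x gF xi Pm Qm x0 beta eta tau t w)))).
  by case: (traj_grad_sqint x0 beta eta tau F_grad F_int L0 g_lip gF_int gF_var
    mxi xi_law Pm_unif Qm_unif indep t).
rewrite (eq_bigr (fun t : 'I_T =>
  (\int[P]_w psqnorm (gradf (traj_x gF xi Pm Qm x0 beta eta tau t w)))%:E)); last first.
  move=> t _; rewrite fineK//; exact: (integrable_fin_num measurableT (Gi t)).
rewrite sumEFin -EFinM lee_fin; exact: rate.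
Qed.
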